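(* Let $0<\alpha<2$ and let $(\mathbb{R}^{\mathbb{Z}},\mathcal{B}^{\otimes\mathbb{Z}},Q,S)$ be the Lévy measure system of a symmetric $\alpha$-stable stationary process. Then there exist a probability space $(X,\mathcal{A},\nu)$, a nonsingular automorphism $R$ of $(X,\mathcal{A},\nu)$, a function $f\in L^{\alpha}(\nu)$ and a measurable map $\xi:X\to\{-1,1\}$ such that, if $M$ denotes the map $(x,t)\mapsto tf(x)$ on $X\times\mathbb{R}^{*}$ and $\overline{R_{\alpha}}$ is defined on $X\times\mathbb{R}^{*}$ by $$\overline{R_{\alpha}}(x,t):=\left(Rx,\;\xi(x)\,t\left(\frac{\mathrm{d}R_{*}^{-1}\nu}{\mathrm{d}\nu}(x)\right)^{1/\alpha}\right),$$ then the map $(x,t)\mapsto\{M\circ\overline{R_{\alpha}}^{\,n}(x,t)\}_{n\in\mathbb{Z}}$ is an isomorphism between the measure-preserving system $(X\times\mathbb{R}^{*},\mathcal{A}\otimes\mathcal{B},\nu\otimes\frac{1}{|s|^{1+\alpha}}\,\mathrm{d}s,\overline{R_{\alpha}})$ and $(\mathbb{R}^{\mathbb{Z}},\mathcal{B}^{\otimes\mathbb{Z}},Q,S)$.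
   Context: All statements about measures and maps are modulo null sets; measure spaces are $\sigma$-finite Lebesgue (standard) spaces. A nonsingular automorphism $R$ of $(X,\mathcal{A},\nu)$ is a bijective bi-measurable map such that the image of $\nu$ under $R$ is equivalent to $\nu$. $R_*^{-1}\nu$ is the image measure of $\nu$ under $R^{-1}$, i.e. $B\mapsto\nu(RB)$. An isomorphism of measure-preserving systems is an invertible (mod null sets) bi-measurable map that intertwines the transformations and sends one measure to the other. $\mathbb{R}^*=\mathbb{R}\setminus\{0\}$ with Borel $\sigma$-algebra $\mathcal{B}$. An IDp process is an infinitely divisible process $Y=\{Y_n\}_{n\in\mathbb{Z}}$ without Gaussian part. The Lévy measure of a stationary IDp process $Y$ is the shift-invariant $\sigma$-finite measure $Q$ on $\mathbb{R}^{\mathbb{Z}}$ with $Q(\{0_{\mathbb{R}^{\mathbb{Z}}}\})=0$, $\int(x_0^2\wedge 1)\,Q(\mathrm{d}\{x_n\}_{n\in\mathbb{Z}})<\infty$ and $$\mathbb{E}\Big[\exp\Big(i\sum_{k=n_1}^{n_2}a_kY_k\Big)\Big]=\exp\Big[\int_{\mathbb{R}^{\mathbb{Z}}}\Big(\exp\Big(i\sum_{k=n_1}^{n_2}a_kx_k\Big)-1-i\sum_{k=n_1}^{n_2}a_kc(x_k)\Big)Q(\mathrm{d}\{x_n\}_{n\in\mathbb{Z}})\Big]$$ for all $n_1\le n_2$ in $\mathbb{Z}$ and real $a_k$, where $c(x)=-1$ if $x<-1$, $c(x)=x$ if $-1\le x\le 1$, $c(x)=1$ if $x>1$. The Lévy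 measure system of $Y$ is $(\mathbb{R}^{\mathbb{Z}},\mathcal{B}^{\otimes\mathbb{Z}},Q,S)$, where $S$ is the shift on $\mathbb{R}^{\mathbb{Z}}$. For $0<\alpha<2$, the $\alpha$-stable stationary processes are the stationary IDp processes whose Lévy measure $Q$ is nonzero and satisfies $(R_t)_*Q=t^{\alpha}Q$ for all $t>0$, where $R_t:\{x_n\}_{n\in\mathbb{Z}}\mapsto\{tx_n\}_{n\in\mathbb{Z}}$ and $(R_t)_*Q$ is the image measure, i.e. $B\mapsto Q(R_t^{-1}B)$. The process $Y$ is symmetric if $Y$ and $-Y$ have the same distribution; then $Q$ is invariant under $\{x_n\}\mapsto\{-x_n\}$. *)

(* Defs.v *)
From HB Require Import structures.
From mathcomp Require Import all_boot all_order all_algebra.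
From mathcomp Require Import all_classical all_reals all_analysis measurable_realfun.
From mathcomp.real_closed Require Import complex.

Set Implicit Arguments.
Unset Strict Implicit.
Unset Printing Implicit Defensive.

Import Order.TTheory GRing.Theory Num.Theory.
Import numFieldNormedType.Exports.

Local Open Scope classical_set_scope.
Local Open Scope ring_scope.

Definition cylinder1 (R : realType) : set (set (int -> R)) :=
  [set C | exists (n : int) (B : set R),
     measurable B /\ C = (fun x : int -> R => x n) @^-1` B].

(* R^Z with the product sigma-algebra *)
Notation bisequence R := (g_sigma_algebraType (@cylinder1 R)).

Definition shiftZ (R : realType) (x : bisequence R) : bisequence R :=
  fun n => x (n + 1).

Definition dilateZ (R : realType) (t : R) (x : bisequence R) : bisequence R :=
  fun n => t * x n.

(* A process indexed by Z is a random element of R^Z: measurability for the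
   product sigma-algebra is measurability of every coordinate. *)

Section processes.
Context {R : realType} {d : measure_display} {W : measurableType d}.
Variable P : probability W R.

Definition stationary_process (Y : {RV P >-> bisequence R}) : Prop :=
  forall B : set (bisequence R), measurable B ->
    distribution P Y ((@shiftZ R) @^-1` B) = distribution P Y B.

Definition symmetric_process (Y : {RV P >-> bisequence R}) : Prop :=
  forall B : set (bisequence R), measurable B ->
    distribution P Y (dilateZ (-1) @^-1` B) = distribution P Y B.

Definition iid (k : nat) (Z : 'I_k -> {RV P >-> bisequence R}) : Prop :=
  (forall (i j : 'I_k) (B : set (bisequence R)), measurable B ->
     distribution P (Z i) B = distribution P (Z j) B) /\
  (forall B : 'I_k -> set (bisequence R), (forall i, measurable (B i)) ->
     P (\bigcap_i (Z i @^-1` B i)) =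
     (\prod_(i < k) fine (distribution P (Z i) (B i)))%:E).

End processes.
Arguments stationary_process {R d W} P Y.
Arguments symmetric_process {R d W} P Y.
Arguments iid {R d W} P [k] Z.

Definition infinitely_divisible (R : realType) (d : measure_display)
    (W : measurableType d) (P : probability W R)
    (Y : {RV P >-> bisequence R}) : Prop :=
  forall k : nat, (0 < k)%N ->
    exists (d' : measure_display) (W' : measurableType d')
      (P' : probability W' R) (Z : 'I_k -> {RV P' >-> bisequence R}),
      iid P' Z /\
      forall B : set (bisequence R), measurable B ->
        P' ((fun w => (fun n => \sum_(i < k) Z i w n) : bisequence R) @^-1` B)
        = distribution P Y B.
Arguments infinitely_divisible {R d W} P Y.

Definition cexp (R : realType) (z : R[i]) : R[i] :=
  Complex (expR (complex.Re z) * cos (complex.Im z))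
          (expR (complex.Re z) * sin (complex.Im z)).

Definition cintegral (R : realType) (d : measure_display)
    (T : measurableType d) (mu : {measure set T -> \bar R})
    (f : T -> R[i]) : R[i] :=
  Complex (\int[mu]_x complex.Re (f x)) (\int[mu]_x complex.Im (f x)).

Definition truncation (R : realType) (x : R) : R :=
  if x < -1 then -1 else if x <= 1 then x else 1.

(* a_{n1} x_{n1} + ... + a_{n2} x_{n2}, for n1 <= n2 *)
Definition lincomb (R : realType) (n1 n2 : int) (a x : int -> R) : R :=
  \sum_(i < `|n2 - n1|%N.+1) a (n1 + i%:Z) * x (n1 + i%:Z).

Section Levy_measure.
Context {R : realType} {d : measure_display} {W : measurableType d}.
Variables (P : probability W R) (Y : {RV P >-> bisequence R}).
Variable Q : {sigma_finite_measure set (bisequence R) -> \bar R}.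

(* The absence of a Gaussian part is the absence of a quadratic term in the
   exponent.  The integrand there is Q-integrable, thanks to [levy_int] and
   [levy_shift], so the real-valued integrals are genuine ones. *)
Record is_Levy_measure : Prop := IsLevyMeasure {
  levy_shift : forall B : set (bisequence R), measurable B ->
    Q ((@shiftZ R) @^-1` B) = Q B;
  levy_0 : Q [set (fun=> 0)] = 0%E;
  levy_int : (\int[Q]_x (Num.min ((x : int -> R) 0 ^+ 2) 1)%:E < +oo)%E;
  levy_khintchine : forall (n1 n2 : int) (a : int -> R), n1 <= n2 ->
    cintegral P (fun w => cexp (Complex 0 (lincomb n1 n2 a (Y w)))) =
    cexp (cintegral Q (fun x =>
      cexp (Complex 0 (lincomb n1 n2 a x)) - 1
      - Complex 0 (lincomb n1 n2 a (fun n => truncation (x n)))))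
}.

Record is_stationary_IDp : Prop := IsStationaryIDp {
  idp_stationary : stationary_process P Y;
  idp_divisible : infinitely_divisible P Y;
  idp_levy : is_Levy_measure
}.

Record is_stable (alpha : R) : Prop := IsStable {
  stable_IDp : is_stationary_IDp;
  stable_neq0 : Q setT != 0%E;
  stable_scaling : forall (t : R) (B : set (bisequence R)),
    0 < t -> measurable B ->
    pushforward Q (dilateZ t) B = ((t `^ alpha)%:E * Q B)%E
}.

End Levy_measure.
Arguments is_Levy_measure {R d W} P Y Q.
Arguments is_stationary_IDp {R d W} P Y Q.
Arguments is_stable {R d W} P Y Q alpha.

(* The Borel structure of a Polish space; with a sigma-finite measure, such a
   space is a Lebesgue space modulo null sets. *)
Definition standard_borel (R : realType) (d : measure_display)
    (T : measurableType d) : Prop :=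
  exists (V : completePseudoMetricType R) (g : T -> V),
    [/\ hausdorff_space V,
        (exists2 D : set V, countable D & dense D),
        bijective g &
        forall A : set T, measurable A <-> <<s @open V >> (g @` A)].

(* A system lives on a measurable subset [D] of the ambient type, with
   trace sigma-algebra. *)
Section systems.
Context {R : realType} {d1 d2 : measure_display}
  {T1 : measurableType d1} {T2 : measurableType d2}.

Definition measure_preserving (D : set T1) (mu : set T1 -> \bar R)
    (S : T1 -> T1) : Prop :=
  [/\ measurable D, set_fun D D S, measurable_fun D S &
      forall B, measurable B -> B `<=` D -> mu (D `&` S @^-1` B) = mu B].

Definition mps_isomorphism
    (D1 : set T1) (mu1 : set T1 -> \bar R) (S1 : T1 -> T1)
    (D2 : set T2) (mu2 : set T2 -> \bar R) (S2 : T2 -> T2)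
    (phi : T1 -> T2) : Prop :=
  exists (A1 : set T1) (A2 : set T2),
  [/\ [/\ measurable A1, A1 `<=` D1 & mu1 (D1 `\` A1) = 0%E],
      [/\ measurable A2, A2 `<=` D2 & mu2 (D2 `\` A2) = 0%E],
      [/\ set_bij A1 A2 phi, measurable_fun A1 phi &
          forall B, measurable B -> B `<=` A1 -> measurable (phi @` B)],
      (forall B, measurable B -> B `<=` A2 ->
         mu1 (A1 `&` phi @^-1` B) = mu2 B) &
      (forall x, A1 x -> phi (S1 x) = S2 (phi x))].

End systems.

Section radial_measure.
Context {R : realType}.
Variable alpha : R.
Local Notation leb := (@lebesgue_measure R).

Let density : R -> \bar R := EFin \o (fun s => `|s| `^ (- (1 + alpha))).

(* The measure |s|^{-(1 + alpha)} ds; the point 0 is Lebesgue-null. *)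
Definition radial_measure (A : set R) : \bar R :=
  (\int[leb]_(s in A) density s)%E.

Let density_ge0 s : (0 <= density s)%E.
Proof. by rewrite lee_fin powR_ge0. Qed.

Let measurable_density : measurable_fun setT density.
Proof.
apply/measurable_EFinP.
by apply: (measurableT_comp (measurable_powR _)).
Qed.

Let radial0 : radial_measure set0 = 0%E.
Proof. exact: integral_set0. Qed.

Let radial_ge0 A : (0 <= radial_measure A)%E.
Proof. by apply: integral_ge0. Qed.

Let radial_sigma_additive : semi_sigma_additive radial_measure.
Proof.
move=> /= F mF tF mUF; rewrite /radial_measure; apply: cvg_toP.
  apply: ereal_nondecreasing_is_cvgn => m n mn.
  by apply: lee_sum_nneg_natr => // k _ _; apply: integral_ge0.
by rewrite ge0_integral_bigcup//=; exact/measurable_funTS.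
Qed.

HB.instance Definition _ := isMeasure.Build _ _ _
  radial_measure radial0 radial_ge0 radial_sigma_additive.

Let radial_sigma_finite : sigma_finite setT radial_measure.
Proof.
pose E (n : nat) := [set s : R | (density s <= n%:R%:E)%E].
have mE n : measurable (E n).
  by rewrite -[E n]setTI; apply: emeasurable_fun_infty_c.
exists (fun n => E n `&` `[- n%:R, n%:R]%classic).
  apply/esym; rewrite -subTset => s _.
  pose n := (Num.bound (Num.max `|s| (`|s| `^ (- (1 + alpha))))).
  have : Num.max `|s| (`|s| `^ (- (1 + alpha))) <= n%:R.
    by apply/ltW/archi_boundP; rewrite le_max normr_ge0.
  rewrite ge_max => /andP[s1 s2]; exists n => //; split => /=.
    by rewrite /E /= lee_fin.
  by rewrite in_itv /= -ler_norml.
move=> n; split; first exact: measurableI.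
set A := _ `&` _; have mA : measurable A by exact: measurableI.
have leA : (radial_measure A <= \int[leb]_(s in A) (cst n%:R%:E s))%E.
  apply: ge0_le_integral => //.
  - exact/measurable_funTS.
  - by move=> s [].
rewrite (le_lt_trans leA)// integral_cst// lte_mul_pinfty//.
pose I : set R := `[- n%:R, n%:R]%classic.
have leA' : (leb A <= leb I)%E.
  apply: le_measure; [exact: mem_set|apply: mem_set|by move=> ? []].
  exact: measurable_itv.
rewrite (le_lt_trans leA')//.
by rewrite lebesgue_measure_itv/=; case: ifP => // _; rewrite -EFinD ltry.
Qed.

HB.instance Definition _ := Measure_isSigmaFinite.Build _ _ _
  radial_measure radial_sigma_finite.

End radial_measure.

Section nonsingular.
Context {R : realType} {d : measure_display} {X : measurableType d}.
Variables (nu : probability X R) (S Sinv : {mfun X >-> X}).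

Definition nonsingular_automorphism : Prop :=
  [/\ cancel S Sinv, cancel Sinv S,
      distribution nu S `<< nu & nu `<< distribution nu S].

(* The derivative d(S_*^{-1} nu)/d nu, where S_*^{-1} nu is the image of nu under
   S^{-1}, that is B |-> nu (S B).  For a nonsingular S it is finite and positive
   nu-almost everywhere; changing its value to 1 on the exceptional null set
   makes the skew product below a bijection of X * R^*. *)
Definition rn_density (x : X) : R :=
  let r := fine (Radon_Nikodym
    (charge_of_finite_measure (distribution nu Sinv)) nu x) in
  if 0 < r then r else 1.

Lemma rn_density_gt0 x : 0 < rn_density x.
Proof. by rewrite /rn_density; case: ifP. Qed.

Variables (alpha : R) (xi : X -> R).

Definition cocycle (x : X) : R := xi x * rn_density x `^ alpha^-1.

Definition maharam (p : X * R) : X * R := (S p.1, cocycle p.1 * p.2).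

Definition maharam_inv (p : X * R) : X * R :=
  (Sinv p.1, (cocycle (Sinv p.1))^-1 * p.2).

Lemma cocycle_neq0 x : xi x != 0 -> cocycle x != 0.
Proof. by move=> xi0; rewrite mulf_neq0// gt_eqF// powR_gt0// rn_density_gt0. Qed.

Lemma maharamK : cancel S Sinv -> (forall x, xi x != 0) ->
  cancel maharam maharam_inv.
Proof.
by move=> SK xi0 [x t]; rewrite /maharam_inv/= SK mulKf// cocycle_neq0.
Qed.

Lemma maharam_invK : cancel Sinv S -> (forall x, xi x != 0) ->
  cancel maharam_inv maharam.
Proof.
by move=> SK xi0 [x t]; rewrite /maharam/= SK mulVKf// cocycle_neq0.
Qed.

Definition maharam_iter (n : int) : X * R -> X * R :=
  match n with
  | Posz k => iter k maharam
  | Negz k => iter k.+1 maharam_inv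
  end.

Definition maharam_factor (f : X -> R) (p : X * R) : bisequence R :=
  fun n => let q := maharam_iter n p in q.2 * f q.1.

End nonsingular.

(* Main.v *)
(** Being symmetric and stable, the Levy measure Q is invariant under x |-> - x
    and scaled by t^alpha under x |-> t x, so in polar coordinates it is a product.
    Let N be a measurable function on R^Z with N (t x) = t N x, vanishing only at 0:
    a suitably weighted first nonzero coordinate.  Then x |-> (x / N x, N x) maps Q
    to nu * |s|^(-1-alpha) ds, for a probability nu carried by the cross-section
    {N = 1}.  The shift acts on directions by S x = shift x / N (shift x), its
    effect on the radius is multiplication by N (shift x), and its invariance
    forces d(S_*^-1 nu)/d nu = |N (shift x)|^alpha; hence polar coordinates
    conjugate the shift with the skew product for xi = sign N (shift x), and
    M (x, t) = t x_0 is the coordinate at 0.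

    The symmetry of Q is a uniqueness statement: symmetry of Y makes the imaginary
    part of the Levy exponent vanish (it is continuous and lies in pi Z), and its
    second differences are the sine transforms of the finite measures
    (1 - cos (c x_n)) Q, which are therefore invariant under reflection. *)
Require Import Defs.
From HB Require Import structures.
From mathcomp Require Import all_boot all_order all_algebra.
From mathcomp Require Import all_classical all_reals all_analysis measurable_realfun.
From mathcomp.real_closed Require Import complex.
From mathcomp Require Import ring lra.

Set Implicit Arguments.
Unset Strict Implicit.
Unset Printing Implicit Defensive.

Import Order.TTheory GRing.Theory Num.Theory.
Import numFieldNormedType.Exports.

Local Open Scope classical_set_scope.
Local Open Scope ring_scope.

(** * R^Z as a standard Borel space *)

(** By scaling, a nonzero Q has infinite mass, so it can be neither normalised nor treated directly
    as a finite measure with a Fourier transform; most of the work goes around this. For the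
    symmetry, a weight 1 - cos (c x_n) is dominated by a multiple of min(x_n^2, 1), whose integral
    is finite, and countably many such weights together see every nonzero sequence. Fourier
    uniqueness itself is replaced by a closure argument: bounded pointwise limits of trigonometric
    polynomials include all indicators of measurable sets. The gauge N has to be finite on every
    sequence, which no norm is, and odd, so that its cross-section contains only one of x and -x and
    the radius ranges over all of R^*. Its weights make Q {|N| > 1} finite; rescaling this mass to 2
    / alpha, the radial mass of {|s| > 1}, makes nu a probability. The value of the Radon-Nikodym
    derivative is known only almost everywhere, whereas the isomorphism is pointwise. The argument
    therefore lives on the sequences all of whose shifts have a good direction, a conull set because
    Z is countable. *)

Definition seqZ (R : realType) : Type := int -> R.

Section seqZ_metric.
Context {R : realType}.

HB.instance Definition _ := gen_eqMixin (seqZ R).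
HB.instance Definition _ := gen_choiceMixin (seqZ R).
HB.instance Definition _ := isPointed.Build (seqZ R) (fun=> 0).

(** A metric for the product topology without infinite sums: radius [e] constrains only the
    coordinates with |n| < 1/e. A larger radius constrains fewer coordinates, whence the triangle
    inequality; coordinate 0 is always constrained, so balls of nonpositive radius are empty. *)
Definition seqZ_ball (x : seqZ R) (e : R) : set (seqZ R) :=
  [set y | forall n : int, `|n|%N%:R * e < 1 -> `|x n - y n| < e].

Let ent : set_system (seqZ R * seqZ R) := entourage_ seqZ_ball.

Let seqZ_nbhs (x : seqZ R) : set_system (seqZ R) := nbhs_ ent x.

Let seqZ_nbhsE : seqZ_nbhs = nbhs_ ent. Proof. by []. Qed.

HB.instance Definition _ := hasNbhs.Build (seqZ R) seqZ_nbhs.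

Let seqZ_ball_gt0 x e y : seqZ_ball x e y -> 0 < e.
Proof.
by move=> /(_ 0); rewrite absz0 mul0r => /(_ ltr01); exact: le_lt_trans.
Qed.

Let seqZ_ball_center x (e : R) : 0 < e -> seqZ_ball x e x.
Proof. by move=> e0 n _; rewrite subrr normr0. Qed.

Let seqZ_ball_sym x y (e : R) : seqZ_ball x e y -> seqZ_ball y e x.
Proof. by move=> xy n ne; rewrite distrC xy. Qed.

Let seqZ_ball_triangle x y z e1 e2 :
  seqZ_ball x e1 y -> seqZ_ball y e2 z -> seqZ_ball x (e1 + e2) z.
Proof.
move=> xy yz n ne; have e10 := seqZ_ball_gt0 xy; have e20 := seqZ_ball_gt0 yz.
rewrite -(subrKA (y n)) (le_lt_trans (ler_normD _ _))// ltrD//.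
  by apply: xy; rewrite (le_lt_trans _ ne)// ler_wpM2l// lerDl ltW.
by apply: yz; rewrite (le_lt_trans _ ne)// ler_wpM2l// lerDr ltW.
Qed.

HB.instance Definition _ := @Nbhs_isPseudoMetric.Build R (seqZ R)
  ent seqZ_nbhsE seqZ_ball seqZ_ball_center seqZ_ball_sym seqZ_ball_triangle erefl.

Let ballE (x : seqZ R) (e : R) : ball x e = seqZ_ball x e.
Proof. by []. Qed.

Lemma seqZ_ball_coord (x : seqZ R) (n : int) (e : R) : 0 < e ->
  exists2 d, 0 < d & forall y, ball x d y -> `|x n - y n| < e.
Proof.
move=> e0; pose d := Num.min e (`|n|%N.+1%:R)^-1.
have d0 : 0 < d by rewrite lt_min e0 invr_gt0 ltr0n.
have nd : `|n|%N%:R * d < 1.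
  rewrite (@le_lt_trans _ _ (`|n|%N%:R / (`|n|%N.+1%:R)))//.
    by rewrite ler_wpM2l// ge_min lexx orbT.
  by rewrite ltr_pdivrMr// mul1r ltr_nat.
by exists d => // y /(_ n nd) xy; rewrite (lt_le_trans xy)// /d ge_min lexx.
Qed.

Lemma seqZ_complete (F : set_system (seqZ R)) : ProperFilter F ->
  cauchy F -> cvg F.
Proof.
move=> FF /cauchyP Fc.
pose Fn n : set_system R := (fun x : seqZ R => x n) @ F.
have Fncvg n : cvg (Fn n).
  have FnF : ProperFilter (Fn n) by exact: fmap_proper_filter.
  suff /(@cauchy_exP R R (Fn n) _) Fnc : cauchy_ex (Fn n).
    by have := @cauchy_cvg R (Fn n) FnF Fnc; apply.
  move=> e e0.
  have e20 : 0 < e / 2 by rewrite divr_gt0.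
  have [d d0 [ed1 ed2]] : exists2 d, 0 < d & `|n|%N%:R * d < 1 /\ d <= e.
    exists (Num.min e (`|n|%N.+1%:R)^-1).
      by rewrite lt_min e0 invr_gt0 ltr0n.
    rewrite ge_min lexx; split => //.
    rewrite (@le_lt_trans _ _ (`|n|%N%:R / (`|n|%N.+1%:R)))//.
      by rewrite ler_wpM2l// ge_min lexx orbT.
    by rewrite ltr_pdivrMr// mul1r ltr_nat.
  have [x Fx] := Fc _ d0; exists (x n).
  suff : F [set y | ball (x n) e (y n)] by [].
  apply: filterS Fx => y xy; rewrite /ball/=.
  by apply: lt_le_trans ed2; exact: xy ed1.
have /choice[l Fnl] : forall n, exists a : R, Fn n --> a.
  by move=> n; exists (lim (Fn n)).
apply/cvg_ex; exists (l : seqZ R).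
apply/cvg_ballP => e e0.
have e40 : 0 < e / 4 by rewrite divr_gt0.
have [x Fx] := Fc _ e40.
apply: filterS (Fx) => y xy; rewrite ballE => n ne.
have ne4 : `|n|%N%:R * (e / 4) < 1.
  by rewrite (le_lt_trans _ ne)// ler_wpM2l//; lra.
(* The intermediate point [z] may depend on the coordinate [n], so no uniformity of the
   coordinatewise convergence is required. *)
have : F [set y | ball (l n) (e / 4) (y n)].
  by apply: (Fnl n); exact: nbhsx_ballx.
move=> Fl; have [z [xz lz]] := filter_ex (filterI Fx Fl).
have h1 : `|x n - y n| < e / 4 by exact: xy.
have h2 : `|x n - z n| < e / 4 by exact: xz.
have h3 : `|l n - z n| < e / 4 by exact: lz.
have -> : l n - y n = (l n - z n) + ((z n - x n) + (x n - y n)) by ring.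
rewrite (le_lt_trans (ler_normD _ _))//.
rewrite (@le_lt_trans _ _ (`|l n - z n| + (`|z n - x n| + `|x n - y n|)))//.
  by rewrite lerD2l ler_normD.
by rewrite [`|z n - _|]distrC; lra.
Qed.

HB.instance Definition _ := Uniform_isComplete.Build (seqZ R) seqZ_complete.

Lemma seqZ_hausdorff : hausdorff_space (seqZ R).
Proof.
rewrite ball_hausdorff => x y xy.
have [n /eqP xyn] : exists n, x n <> y n.
  by apply/existsNP => h; move/eqP: xy; apply; apply/funext.
have e0 : 0 < `|x n - y n| / 2 by rewrite divr_gt0// normr_gt0 subr_eq0.
have [d1 d10 h1] := seqZ_ball_coord x n e0.
have [d2 d20 h2] := seqZ_ball_coord y n e0.
exists (PosNum d10, PosNum d20) => /=.
apply/eqP; rewrite -subset0 => z [/h1 xz /h2 yz].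
have := ler_distD (z n) (x n) (y n); rewrite (distrC (z n)) leNgt => /negP; apply.
by rewrite [ltRHS]splitr ltrD.
Qed.

Definition seqZ_rat (s : seq rat * seq rat) : seqZ R :=
  fun n => match n with Posz k => ratr (nth 0 s.1 k) | Negz k => ratr (nth 0 s.2 k) end.

(** A ball constrains finitely many coordinates, so rational sequences that vanish outside a finite
    window reach it. *)
Lemma seqZ_rat_ball (x : seqZ R) (e : R) : 0 < e -> exists s, ball x e (seqZ_rat s).
Proof.
move=> e0.
have /choice[q xq] : forall n : int, exists q : rat, `|x n - ratr q| < e.
  move=> n; have : x n - e < x n + e by rewrite ltrD2l gtrN.
  by move=> /rat_in_itvoo[q]; rewrite in_itv/= -ltr_distlC => xq; exists q.
pose K := Num.bound e^-1.
have Ke n : n%:R * e < 1 -> (n < K)%N.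
  rewrite -ltr_pdivlMr// mul1r => ne; rewrite -(ltr_nat R) (lt_trans ne)//.
  by apply: archi_boundP; rewrite invr_ge0 ltW.
exists (mkseq (q \o Posz) K, mkseq (q \o Negz) K); rewrite ballE => -[k|k] /Ke kK /=.
  by rewrite nth_mkseq.
by rewrite nth_mkseq// ltnW.
Qed.

Lemma seqZ_open_coord (n : int) (a : R) : open [set x : seqZ R | a < x n].
Proof.
rewrite openE => x /= ax; rewrite /interior -nbhs_ballE.
have e0 : 0 < x n - a by rewrite subr_gt0.
have [d d0 xd] := seqZ_ball_coord x n e0.
by exists d => //= y /xd; rewrite ltr_distlC => /andP[+ _]; rewrite opprB addrC subrK.
Qed.

Lemma measurable_seqZ_ball (x : seqZ R) (e : R) :
  measurable (ball x e : set (bisequence R)).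
Proof.
rewrite ballE; have -> : seqZ_ball x e = \bigcap_n
    (if unpickle n is Some k then
       if `|k|%N%:R * e < 1 then (fun y : bisequence R => y k) @^-1` [set t | `|x k - t| < e]
       else setT
     else setT).
  apply/seteqP; split=> [y xy n _|y xy n ne].
    by case: unpickle => // k; case: ifPn => // /xy.
  by have := xy (pickle n) I; rewrite pickleK ne.
apply: bigcap_measurableType => n _; case: unpickle => // k; case: ifP => // _.
apply: sub_sigma_algebra; exists k, [set t | `|x k - t| < e]; split=> //.
rewrite (_ : mkset _ = ball (x k) e)//; exact: measurable_ball.
Qed.

(** Half-line conditions on a coordinate are open, and by separability every open set is a countable
    union of balls, which are measurable for the product; hence the Borel and the product
    sigma-algebras coincide. *)
Lemma standard_borel_bisequence : standard_borel R (bisequence R).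
Proof.
exists (seqZ R), (id : bisequence R -> seqZ R); split.
- exact: seqZ_hausdorff.
- exists (range seqZ_rat); first exact: card_le_trans (card_image_le _ _) (countableP _).
  move=> O [x Ox]; rewrite openE => /(_ _ Ox).
  rewrite /interior -nbhs_ballE => -[e /= e0 xeO].
  by have [s xs] := seqZ_rat_ball x e0; exists (seqZ_rat s); split; [exact: xeO|exists s].
- by exists id.
move=> A; rewrite image_id; split.
  apply: smallest_sub; first exact: smallest_sigma_algebra.
  move=> _ [n [B [mB ->]]].
  have : measurable_fun setT
      ((fun x => x n) : g_sigma_algebraType (@open (seqZ R)) -> R).
    apply: (measurability _ (RGenOInfty.measurableE R)) => //.
    move=> /= _ [_ [a ->] <-]; rewrite setTI; apply: sub_sigma_algebra.
    rewrite (_ : _ @^-1` _ = [set x : seqZ R | a < x n]); first exact: seqZ_open_coord.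
    by apply/seteqP; split=> y; rewrite /= in_itv/= andbT.
  by move=> /(_ measurableT _ mB); rewrite setTI.
apply: smallest_sub; first exact: smallest_sigma_algebra.
move=> O; rewrite openE => oO.
pose B (s : (seq rat * seq rat) * nat) : set (bisequence R) := ball (seqZ_rat s.1) (s.2.+1%:R)^-1.
suff -> : O = \bigcup_(s in setT) (if `[< B s `<=` O >] then B s else set0).
  apply: countable_bigcupT_measurable; first exact: countableP.
  by move=> s; case: asboolP => // _; exact: measurable_seqZ_ball.
apply/seteqP; split=> [x /oO|x [s _]]; last by case: asboolP => // sO /sO.
rewrite /interior -nbhs_ballE => -[e /= e0 xeO].
(* A centre within 1/(k+1) of [x] has a ball of that radius which contains [x] and stays inside the
   ball of radius [e] around [x]. *)
pose k := Num.bound (2 / e).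
have k0 : 0 < (k.+1%:R)^-1 :> R by rewrite invr_gt0.
have ke : (k.+1%:R)^-1 + (k.+1%:R)^-1 <= e.
  rewrite -mulr2n -(mulr_natl _ 2) ler_pdivrMr// -ler_pdivrMl// mulrC.
  rewrite ltW// (@lt_le_trans _ _ k%:R)//; last by rewrite ler_nat.
  by apply: archi_boundP; rewrite divr_ge0// ltW.
have [s xs] := seqZ_rat_ball x k0.
exists (s, k) => //; case: asboolP => [_|]; first exact: ball_sym.
move=> []; move=> y; rewrite /B/= => sy; apply: xeO; apply: le_ball ke _ _.
exact: ball_triangle xs sy.
Qed.

End seqZ_metric.

(** * Bounded pointwise closure of an algebra of functions *)

Section bounded_closure.
Context {R : realType} {T : Type}.
Implicit Types (G : set (T -> R)) (f g : T -> R).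

(** A functional form of the monotone class argument: an identity between integrals against a finite
    measure that holds on [G] extends by induction, the limit case being dominated convergence. *)
Inductive bounded_closure G : (T -> R) -> Prop :=
| BClosureGen f : G f -> bounded_closure G f
| BClosureLin (c : R) f g : bounded_closure G f -> bounded_closure G g ->
    bounded_closure G (fun x => c * f x + g x)
| BClosureLim (F : nat -> T -> R) f (M : R) :
    (forall n, bounded_closure G (F n)) -> (forall n x, `|F n x| <= M) ->
    (forall x, F n x @[n --> \oo] --> f x) -> bounded_closure G f.

Variable G : set (T -> R).
Hypothesis G1 : G (cst 1).
Hypothesis G_bounded : forall f, G f -> exists M, forall x, `|f x| <= M.
Hypothesis GM : forall f g, G f -> G g -> bounded_closure G (fun x => f x * g x).
Local Notation C := (bounded_closure G).

Lemma bclosure_bounded f : C f -> exists M, forall x, `|f x| <= M.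
Proof.
elim=> {f} [f /G_bounded//|c f g _ [M fM] _ [N gN]|F f M _ _ FM Ff].
  exists (`|c| * M + N) => x; rewrite (le_trans (ler_normD _ _))// lerD//.
  by rewrite normrM ler_wpM2l.
exists M => x; apply: (cvgr_to_le (cvg_norm (Ff x))).
exact: nearW.
Qed.

Let bclosureM_gen f g : C f -> G g -> C (fun x => f x * g x).
Proof.
move=> Cf Gg; elim: Cf => {f} [f Gf|c f1 f2 _ IH1 _ IH2|F f M _ IH FM Ff].
- exact: GM.
- rewrite (_ : (fun x => _) = (fun x => c * (f1 x * g x) + f2 x * g x)).
    exact: BClosureLin.
  by apply/funext => x; ring.
have [N gN] := G_bounded Gg.
apply: (@BClosureLim _ (fun n x => F n x * g x) _ (M * N)) => //.
  by move=> n x; rewrite normrM ler_pM.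
by move=> x; apply: cvgM; [exact: Ff|exact: cvg_cst].
Qed.

(** Two inductions: one factor is first held in [G] while the other runs through the closure, then
    the roles are exchanged. *)
Lemma bclosureM f g : C f -> C g -> C (fun x => f x * g x).
Proof.
move=> Cf; elim=> {g} [g Gg|c g1 g2 _ IH1 _ IH2|F g M _ IH FM Fg].
- exact: bclosureM_gen.
- rewrite (_ : (fun x => _) = (fun x => c * (f x * g1 x) + f x * g2 x)).
    exact: BClosureLin.
  by apply/funext => x; ring.
have [N fN] := bclosure_bounded Cf.
apply: (@BClosureLim _ (fun n x => f x * F n x) _ (N * M)) => //.
  by move=> n x; rewrite normrM ler_pM.
by move=> x; apply: cvgM; [exact: cvg_cst|exact: Fg].
Qed.

Lemma bclosure_cst c : C (fun=> c).
Proof.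
have C1 : C (cst 1) by exact: BClosureGen.
rewrite (_ : (fun=> c) = (fun x : T => (c - 1) * cst 1 x + cst 1 x)).
  exact: BClosureLin.
by apply/funext => x /=; ring.
Qed.

Lemma bclosureZ c f : C f -> C (fun x => c * f x).
Proof.
move=> Cf; rewrite (_ : (fun x => _) = (fun x => c * f x + 0)).
  exact/BClosureLin/bclosure_cst.
by apply/funext => x; rewrite addr0.
Qed.

Lemma bclosureD f g : C f -> C g -> C (fun x => f x + g x).
Proof.
move=> Cf Cg; rewrite (_ : (fun x => _) = (fun x => 1 * f x + g x)).
  exact: BClosureLin.
by apply/funext => x; rewrite mul1r.
Qed.

Lemma bclosureB f g : C f -> C g -> C (fun x => f x - g x).
Proof.
move=> Cf Cg; rewrite (_ : (fun x => _) = (fun x => f x + (-1) * g x)).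
  exact/bclosureD/bclosureZ.
by apply/funext => x; rewrite mulN1r.
Qed.

Lemma bclosureX n f : C f -> C (fun x => f x ^+ n).
Proof.
move=> Cf; elim: n => [|n IH].
  by rewrite (_ : (fun x => _) = cst 1)//; exact: BClosureGen.
rewrite (_ : (fun x => _) = (fun x => f x * f x ^+ n)); first exact: bclosureM.
by apply/funext => x; rewrite exprS.
Qed.

Lemma bclosure_sum (F : nat -> T -> R) n : (forall i, C (F i)) ->
  C (fun x => \sum_(i < n) F i x).
Proof.
move=> CF; elim: n => [|n IH].
  rewrite (_ : (fun x => _) = (fun=> 0)); first exact: bclosure_cst.
  by apply/funext => x; rewrite big_ord0.
rewrite (_ : (fun x => _) = (fun x => \sum_(i < n) F i x + F n x)).
  exact: bclosureD.
by apply/funext => x; rewrite big_ord_recr.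
Qed.

Lemma bclosure_prod (F : nat -> T -> R) n : (forall i, C (F i)) ->
  C (fun x => \prod_(i < n) F i x).
Proof.
move=> CF; elim: n => [|n IH].
  rewrite (_ : (fun x => _) = (fun=> 1)); first exact: bclosure_cst.
  by apply/funext => x; rewrite big_ord0.
rewrite (_ : (fun x => _) = (fun x => \prod_(i < n) F i x * F n x)).
  exact: bclosureM.
by apply/funext => x; rewrite big_ord_recr.
Qed.

Lemma bclosure_comp_sign f : C f -> (forall x, `|f x| <= 1) ->
  C (fun x => Num.sg (f x)).
Proof.
(* The iterates of t |-> (3 t - t^3) / 2 converge to the sign on [-1, 1]. *)
move=> Cf f1; pose s (t : R) := 3 / 2 * t - 1 / 2 * t ^+ 3.
have sN t : s (- t) = - s t by rewrite /s; field.
have s_pos t : 0 < t <= 1 -> t <= s t <= 1.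
  move=> /andP[t0 t1]; rewrite /s; apply/andP; split; first by nra.
  rewrite -subr_ge0 (_ : _ - _ = (1 - t) ^+ 2 * (2 + t) / 2); last by field.
  by rewrite divr_ge0// mulr_ge0 ?sqr_ge0// addr_ge0// ltW.
have itersN n t : iter n s (- t) = - iter n s t by elim: n => //= n ->.
have iters_pos n t : 0 < t <= 1 -> t <= iter n s t <= 1.
  move=> t01; elim: n => [|n /andP[tn n1]] /=.
    by rewrite lexx; case/andP : t01.
  have /s_pos/andP[h ->] : 0 < iter n s t <= 1.
    by rewrite n1 andbT (lt_le_trans _ tn)//; case/andP : t01.
  by rewrite andbT (le_trans tn).
have iters_cvg_pos t : 0 < t <= 1 -> iter n s t @[n --> \oo] --> (1 : R).
  move=> t01; have /andP[t0 t1] := t01.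
  (* One iteration multiplies the gap [1 - u] by (1 - u)(2 + u)/2 = 1 - u/2 - u^2/2, which is at
     most [1 - t / 2] because the iterates stay above [t]. *)
  have bnd n : 1 - iter n s t <= (1 - t / 2) ^+ n.
    elim: n => [|n IH] /=; first by rewrite expr0; lra.
    have /andP[tn n1] := iters_pos n _ t01; set u := iter n s t in IH tn n1 *.
    have -> : 1 - s u = (1 - u) * ((1 - u) * (2 + u) / 2) by rewrite /s; field.
    have u0 : 0 <= u by rewrite (le_trans _ tn)// ltW.
    have u2 : 0 <= u ^+ 2 by rewrite sqr_ge0.
    rewrite exprSr ler_pM// ?subr_ge0//.
      by rewrite divr_ge0// mulr_ge0// ?subr_ge0// addr_ge0.
    have -> : (1 - u) * (2 + u) / 2 = 1 - u / 2 - u ^+ 2 / 2 by field.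
    lra.
  apply: (@squeeze_cvgr _ _ _ _ (fun n => 1 - (1 - t / 2) ^+ n) (cst 1)).
  - apply: nearW => n /=; have /andP[_ ->] := iters_pos n _ t01.
    by rewrite andbT; have := bnd n; lra.
  - rewrite -[X in _ --> X]subr0; apply: cvgB; first exact: cvg_cst.
    by apply: cvg_expr; rewrite ger0_norm; lra.
  - exact: cvg_cst.
apply: (@BClosureLim _ (fun n x => iter n s (f x)) _ 1).
- elim=> [//|n IH].
  rewrite (_ : (fun x => _) = (fun x => 3 / 2 * (iter n s (f x)) - 1 / 2 * (iter n s (f x)) ^+ 3))//.
  by apply: bclosureB; apply: bclosureZ => //; exact: bclosureX.
- move=> n x; have := f1 x; have [fx0|fx0|->] := ltrgt0P (f x); move=> h.
  + have /(iters_pos n)/andP[tn n1]: 0 < f x <= 1 by rewrite fx0 -(gtr0_norm fx0) f1.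
    by rewrite ger0_norm// (le_trans _ tn)// ltW.
  + have /(iters_pos n)/andP[tn n1]: 0 < - f x <= 1.
      by rewrite oppr_gt0 fx0 -(ltr0_norm fx0) f1.
    rewrite -normrN -itersN ger0_norm// (le_trans _ tn)// oppr_ge0 ltW//.
  + suff -> : iter n s 0 = 0 by rewrite normr0.
    by elim: n => //= n ->; rewrite /s expr0n/=; ring.
- move=> x; have := f1 x; have [fx0|fx0|->] := ltrgt0P (f x); move=> h.
  + rewrite gtr0_sg//; apply: iters_cvg_pos.
    by rewrite fx0 -(gtr0_norm fx0) f1.
  + rewrite ltr0_sg//.
    rewrite (_ : (fun n => _) = (fun n => - iter n s (- f x))); last first.
      by apply/funext => n; rewrite itersN opprK.
    apply: cvgN; apply: iters_cvg_pos.
    by rewrite oppr_gt0 fx0 -(ltr0_norm fx0) f1.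
  + rewrite sgr0 (_ : (fun n => _) = (fun n => 0)); first exact: cvg_cst.
    apply/funext => n; elim: n => //= n ->; rewrite /s expr0n/=; ring.
Qed.

Lemma bclosure_indic_gt0 f : C f -> (forall x, `|f x| <= 1) ->
  C (\1_[set x | 0 < f x]).
Proof.
move=> Cf /(bclosure_comp_sign Cf) Cs.
rewrite (_ : \1_ _ = (fun x => 1 / 2 * (Num.sg (f x) ^+ 2 + Num.sg (f x)))).
  by apply: bclosureZ; apply: bclosureD => //; exact: bclosureX.
apply/funext => x; rewrite indicE.
have [x0|x0] := boolP (0 < f x).
  by rewrite mem_set// gtr0_sg//=; field.
rewrite memNset/=; last exact/negP.
by move: x0; rewrite -leNgt le_eqVlt => /predU1P[->|x0];
  rewrite ?sgr0 ?ltr0_sg//; field.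
Qed.

(** Stability under products avoids any detour through disjoint unions: the indicator of a union is
    the bounded limit of 1 minus the partial products of the complementary indicators. *)
Lemma sigma_algebra_bclosure : sigma_algebra setT [set A : set T | C \1_A].
Proof.
split=> [|A CA|A CA] /=.
- by rewrite indic0; exact: bclosure_cst.
- rewrite (_ : \1_ _ = fun x => (cst 1 x : R) - \1_A x).
    by apply: bclosureB => //; exact: bclosure_cst.
  apply/funext => x; rewrite !indicE setTD in_setC.
  by case: (x \in A); rewrite ?subrr ?subr0.
apply: (@BClosureLim _ (fun n x => 1 - \prod_(i < n) (1 - \1_(A i) x)) _ 1).
- move=> n; apply: bclosureB; first exact: bclosure_cst.
  apply: (@bclosure_prod (fun i x => 1 - \1_(A i) x)) => i.
  by apply: bclosureB; [exact: bclosure_cst|exact: CA].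
- move=> n x.
  have /andP[p0 p1] : 0 <= \prod_(i < n) (1 - \1_(A i) x : R) <= 1.
    elim/big_ind : _ => // [|a b /andP[a0 a1] /andP[b0 b1]|i _].
    + by rewrite ler01 lexx.
    + by rewrite mulr_ge0//= mulr_ile1.
    + by rewrite indicE; case: (x \in A i); rewrite ?subrr ?subr0 ?ler01 ?lexx.
  by rewrite ger0_norm; lra.
- move=> x; rewrite indicE; have [[k _ Akx]|nAx] := pselect ((\bigcup_i A i) x).
    rewrite mem_set; last by exists k.
    apply: cvg_near_cst; exists k.+1 => // n /= kn.
    rewrite (bigD1 (Ordinal kn))//= indicE mem_set// subrr mul0r subr0//.
  rewrite memNset//; apply: cvg_near_cst; apply: nearW => n.
  rewrite big1 ?subrr// => i _; rewrite indicE memNset ?subr0// => Aix.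
  by apply: nAx; exists i.
Qed.

End bounded_closure.

(** * Trigonometric polynomials on R^Z *)

Section linear_forms.
Context {R : realType}.
Implicit Types (a x : int -> R) (N : nat).

(** Windows run symmetrically from -N to N - 1, so any two forms become comparable by padding with
    zero coefficients. *)
Definition lform N a x : R :=
  \sum_(i < N) (a (Posz i) * x (Posz i) + a (Negz i) * x (Negz i)).

Lemma lform_widen N M a : exists b, lform (N + M) b = lform N a.
Proof.
pose p (n : int) := match n with Posz k | Negz k => (k < N)%N end.
exists (fun n => if p n then a n else 0); apply/funext => x.
rewrite /lform big_split_ord/= [X in _ + X]big1 ?addr0; last first.
  by move=> i _; rewrite ltnNge leq_addr/= !mul0r addr0.
by apply: eq_bigr => i _; rewrite ltn_ord.
Qed.

Lemma lform_add N a b x : lform N (fun n => a n + b n) x = lform N a x + lform N b x.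
Proof. by rewrite -big_split; apply: eq_bigr => i _ /=; ring. Qed.

Lemma lform_scale N c a x : lform N (fun n => c * a n) x = c * lform N a x.
Proof. by rewrite mulr_sumr; apply: eq_bigr => i _ /=; ring. Qed.

Lemma lform_dilate N c a x : lform N a (fun n => c * x n) = c * lform N a x.
Proof. by rewrite mulr_sumr; apply: eq_bigr => i _ /=; ring. Qed.

Lemma lform_lin N M c a b : exists e, forall x,
  lform (N + M) e x = lform N a x + c * lform M b x.
Proof.
have [a' a'E] := lform_widen N M a; have [b' b'E] := lform_widen M N b.
exists (fun n => a' n + c * b' n) => x.
by rewrite lform_add lform_scale a'E addnC b'E.
Qed.

Lemma lform_coord (n : int) (c : R) : exists N a, forall x, lform N a x = c * x n.
Proof.
exists (match n with Posz k | Negz k => k.+1 end).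
exists (fun m => if m == n then c else 0) => x; rewrite /lform.
case: n => k; rewrite big_ord_recr/= eqxx big1 ?add0r.
- by rewrite mul0r addr0.
- move=> i _; rewrite (_ : (Posz i == Posz k) = false) ?mul0r ?add0r ?mul0r//.
  by apply/eqP => -[ik]; have := ltn_ord i; rewrite ik ltnn.
- by rewrite mul0r add0r.
- move=> i _; rewrite (_ : (Negz i == Negz k) = false) ?mul0r ?add0r ?mul0r//.
  by apply/eqP => -[ik]; have := ltn_ord i; rewrite ik ltnn.
Qed.

Lemma lincomb_lform N a : lincomb (Negz N) (Posz N) a = lform N.+1 a.
Proof.
apply/funext => x; rewrite /lincomb /lform.
have -> : (`|(Posz N - Negz N)%R|%N.+1 = N.+1 + N.+1)%N.
  by rewrite NegzE opprK -PoszD absz_nat addSn.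
rewrite big_split_ord big_split/= addrC; congr (_ + _).
  apply: eq_bigr => i _; suff -> : Negz N + (N.+1 + i)%N%:Z = Posz i by [].
  by rewrite NegzE PoszD addKr.
rewrite (reindex_inj rev_ord_inj)/=; apply: eq_bigr => i _.
suff -> : Negz N + (N.+1 - i.+1)%N%:Z = Negz i by [].
by rewrite -subzn ?ltn_ord// !NegzE addrA addNr add0r.
Qed.

(** The phase [b] puts the sines among the generators and keeps the product-to-sum formula inside
    their span. *)
Definition trig_monomials : set ((int -> R) -> R) :=
  [set f | exists N a b, f = fun x => cos (lform N a x + b)].
Local Notation C := (bounded_closure trig_monomials).

Lemma trig_monomials1 : trig_monomials (cst 1).
Proof.
exists 0%N, (fun=> 0), 0; apply/funext => x /=.
by rewrite /lform big_ord0 addr0 cos0.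
Qed.

Lemma trig_monomials_bounded f :
  trig_monomials f -> exists M, forall x, `|f x| <= M.
Proof. by move=> [N [a [b ->]]]; exists 1 => x; exact: cos_max. Qed.

Lemma trig_monomialsM f g : trig_monomials f -> trig_monomials g ->
  C (fun x => f x * g x).
Proof.
move=> [N [a [b ->]]] [M [a' [b' ->]]].
have [e eE] := lform_lin N M 1 a a'; have [k kE] := lform_lin N M (-1) a a'.
have C1 : C (fun x => cos (lform (N + M) e x + (b + b'))).
  by apply: BClosureGen; exists (N + M)%N, e, (b + b').
have C2 : C (fun x => cos (lform (N + M) k x + (b - b'))).
  by apply: BClosureGen; exists (N + M)%N, k, (b - b').
rewrite (_ : (fun x => _) = (fun x => 2^-1 * (cos (lform (N + M) e x + (b + b')) +
    cos (lform (N + M) k x + (b - b'))))).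
  apply: bclosureZ; first exact: trig_monomials1.
  exact: bclosureD.
apply/funext => x; rewrite eE kE mul1r mulN1r.
have -> : lform N a x + lform M a' x + (b + b') =
  (lform N a x + b) + (lform M a' x + b') by ring.
have -> : lform N a x - lform M a' x + (b - b') =
  (lform N a x + b) - (lform M a' x + b') by ring.
by rewrite cosB [cos (_ + _ + (_ + _))]cosD; field.
Qed.

(** Half-lines on a coordinate suffice. The indicator of {x_n > t} is the limit of those of {sin
    ((x_n - t) / (m+1)) > 0}: for large m the angle lies in ]-pi, pi[, where the sine has the sign
    of its argument. *)
Lemma trig_closure_indic (A : set (bisequence R)) : measurable A -> C \1_A.
Proof.
have sC := sigma_algebra_bclosure trig_monomials1 trig_monomials_bounded trig_monomialsM.
apply: (@smallest_sub _ _ _ [set A : set (int -> R) | C \1_A]) => //.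
move=> _ [n [B [mB ->]]]; move: B mB.
have sCn : sigma_algebra setT [set B : set R | C \1_((fun x : int -> R => x n) @^-1` B)].
  have := sigma_algebra_image (fun x : int -> R => x n) sC.
  rewrite /image_set_system (_ : [set B : set R | _] = [set B | C \1_((fun x : int -> R => x n) @^-1` B)])//.
  by apply/seteqP; split=> B /=; rewrite setTI.
suff : <<s @RGenOInfty.G R >> `<=` [set B : set R | C \1_((fun x : int -> R => x n) @^-1` B)].
  move=> h B mB; apply: h.
  have E : @measurable _ R = <<s @RGenOInfty.G R >> := RGenOInfty.measurableE R.
  by rewrite -E.
apply: smallest_sub => //.
move=> _ [t ->] /=.
pose F m (x : int -> R) := sin (m.+1%:R^-1 * (x n - t)).
have CF m : C (F m).
  have [N [a aE]] := lform_coord n m.+1%:R^-1.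
  apply: BClosureGen; exists N, a, (- (m.+1%:R^-1 * t) - pi / 2).
  by apply/funext => x; rewrite aE /F addrA cosBpihalf mulrBr.
apply: (@BClosureLim _ _ _ (fun m => \1_[set x | 0 < F m x]) _ 1).
- move=> m; apply: bclosure_indic_gt0 => //.
  + exact: trig_monomials1.
  + exact: trig_monomials_bounded.
  + exact: trig_monomialsM.
  + by move=> x; exact: sin_max.
- by move=> m x; rewrite indicE; case: (_ \in _); rewrite ?normr1 ?normr0.
move=> x; apply: cvg_near_cst.
pose K := Num.bound (`|x n - t|).
exists K => // m /= Km; rewrite !indicE; congr (_%:R); congr nat_of_bool.
have mx : `|m.+1%:R^-1 * (x n - t)| < pi.
  rewrite (lt_le_trans _ (pi_ge2 R))// normrM gtr0_norm// ltr_pdivrMl//.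
  have xK : `|x n - t| < K%:R by exact: archi_boundP.
  rewrite (lt_le_trans xK)// (@le_trans _ _ m.+1%:R)//.
    by rewrite ler_nat leqW.
  by rewrite ler_peMr// ler1n.
have -> : (x \in [set x | 0 < F m x]) = (0 < F m x) by apply/idP/idP; rewrite inE.
have -> : (x \in (fun x : int -> R => x n) @^-1` `]t, +oo[%classic) = (t < x n).
  by apply/idP/idP; rewrite inE/= in_itv/= andbT.
rewrite /F; have [tx|xt|<-] := ltrgtP t (x n).
- apply: sin_gt0_pi; rewrite mulr_gt0 ?subr_gt0//=.
  by rewrite (le_lt_trans _ mx)// ler_norm.
- apply/negbTE; rewrite -leNgt -oppr_ge0 -sinN; apply: sin_ge0_pi.
  rewrite -mulrN opprB mulr_ge0 ?subr_ge0 ?(ltW xt)//=.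
  by rewrite -opprB mulrN (le_trans _ (ltW mx))// -normrN ler_norm.
- by rewrite subrr mulr0 sin0 ltxx.
Qed.

End linear_forms.

(** * Reflection invariance from vanishing sine transforms *)

Section bisequence_measurability.
Context {R : realType}.

Lemma measurable_coord (n : int) :
  measurable_fun setT (fun x : bisequence R => (x n : R)).
Proof.
move=> _ B mB; rewrite setTI; apply: sub_sigma_algebra.
by exists n, B.
Qed.

Lemma measurable_bisequence d (T : measurableType d) (f : T -> bisequence R) :
  (forall n, measurable_fun setT (fun t => (f t n : R))) -> measurable_fun setT f.
Proof.
move=> mf; apply: (@measurability _ _ _ _ setT f (@cylinder1 R)) => //.
move=> _ [_ [n [B [mB ->]]] <-]; exact: mf.
Qed.

Lemma measurable_shiftZ : measurable_fun setT (@shiftZ R).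
Proof. by apply: measurable_bisequence => n; exact: measurable_coord. Qed.

Lemma measurable_dilateZ (t : R) : measurable_fun setT (dilateZ t).
Proof.
apply: measurable_bisequence => n; apply: measurable_funM => //.
exact: measurable_coord.
Qed.

Lemma measurable_lform N (a : int -> R) :
  measurable_fun setT (lform N a : bisequence R -> R).
Proof.
apply: measurable_sum => i.
by apply: measurable_funD; apply: measurable_funM => //; exact: measurable_coord.
Qed.

End bisequence_measurability.

Section reflection.
Context {R : realType} (Q : {measure set (bisequence R) -> \bar R}).
Local Notation neg := (dilateZ (-1 : R)).
Local Notation C := (bounded_closure (@trig_monomials R)).

Section weight.
Variable w : bisequence R -> R.
Hypothesis iw : Q.-integrable setT (EFin \o w).
Hypothesis sin_w0 : forall N a, \int[Q]_x (sin (lform N a x) * w x) = 0.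

Let integrable_bounded_w (f : bisequence R -> R) : measurable_fun setT f ->
  (exists M, forall x, `|f x| <= M) ->
  Q.-integrable setT (EFin \o (fun x => f x * w x)).
Proof.
move=> mf [M fM]; have := @integrableMr _ _ _ Q setT measurableT f _ mf _ iw.
apply; exists M; split; first exact: num_real.
by move=> K MK x _; apply: (le_trans (fM x)); exact: ltW.
Qed.

Lemma trig_closure_measurable (f : bisequence R -> R) : C f -> measurable_fun setT f.
Proof.
elim=> {f} [_ [N [a [b ->]]]|c f g _ mf _ mg|F f M _ mF _ Ff].
- apply: measurableT_comp; first exact: continuous_measurable_fun (@continuous_cos R).
  by apply: measurable_funD => //; exact: measurable_lform.
- by apply: measurable_funD => //; exact: measurable_funM.
- by apply: (measurable_fun_cvg mF) => x _; exact: Ff.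
Qed.

(** On a generator, cos (u + b) - cos (- u + b) = - 2 sin b sin u, whose weighted integral vanishes
    by [sin_w0]; limits pass by domination with a multiple of |w|. *)
Lemma integral_trig_closure_neg (f : bisequence R -> R) : C f ->
  (\int[Q]_x (f x * w x)%:E = \int[Q]_x (f (neg x) * w x)%:E)%E.
Proof.
have mneg : measurable_fun setT neg by exact: measurable_dilateZ.
have iC g : C g -> Q.-integrable setT (EFin \o (fun x => g x * w x)).
  move=> Cg; apply: integrable_bounded_w; first exact: trig_closure_measurable.
  have [M gM] := bclosure_bounded (@trig_monomials_bounded R) Cg.
  by exists M => x; exact: gM.
have iCneg g : C g -> Q.-integrable setT (EFin \o (fun x => g (neg x) * w x)).
  move=> Cg; apply: integrable_bounded_w.
    by apply: measurableT_comp mneg; exact: trig_closure_measurable.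
  have [M gM] := bclosure_bounded (@trig_monomials_bounded R) Cg.
  by exists M => x; exact: gM.
move=> Cf; elim: (Cf) => {f Cf} [f Gf|c f g Cf IHf Cg IHg|F f M CF IH FM Ff].
- have Cf : C f by exact: BClosureGen.
  have := integrable_fin_num measurableT (iC _ Cf).
  have := integrable_fin_num measurableT (iCneg _ Cf).
  move=> fn fp; rewrite -(fineK fp) -(fineK fn); congr EFin.
  apply/eqP; rewrite -subr_eq0; apply/eqP.
  have := RintegralB measurableT (iC _ Cf) (iCneg _ Cf); rewrite /Rintegral => <-.
  case: Gf => N [a [b ->]].
  rewrite (_ : fine _ = \int[Q]_x (-2 * sin b * (sin (lform N a x) * w x))).
    rewrite RintegralZl// ?sin_w0 ?mulr0//; apply: integrable_bounded_w.
      apply: measurableT_comp; first exact: continuous_measurable_fun (@continuous_sin R).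
      exact: measurable_lform.
    by exists 1 => x; exact: sin_max.
  apply: eq_Rintegral => x _.
  by rewrite /dilateZ lform_dilate mulN1r !cosD cosN sinN; ring.
- rewrite (_ : (fun x => _) = (fun x => c%:E * (f x * w x)%:E + (g x * w x)%:E)%E); last first.
    by apply/funext => x; rewrite -EFinM -EFinD; congr EFin; ring.
  rewrite [RHS](_ : _ = \int[Q]_x (c%:E * (f (neg x) * w x)%:E + (g (neg x) * w x)%:E))%E; last first.
    by apply: eq_integral => x _; rewrite -EFinM -EFinD; congr EFin; ring.
  rewrite integralD//; [|by apply: integrableZl => //; exact: iC|exact: iC].
  rewrite integralZl//; last exact: iC.
  rewrite integralD//; [|by apply: integrableZl => //; exact: iCneg|exact: iCneg].
  by rewrite integralZl ?IHf ?IHg//; exact: iCneg.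
have Cf : C f by exact: BClosureLim FM Ff.
have iMw : Q.-integrable setT (fun x => (`|M|%:E * `|(w x)%:E|)%E).
  by apply: integrableZl => //; exact: integrable_abse.
have h1 : (\int[Q]_x (F n x * w x)%:E @[n --> \oo] --> \int[Q]_x (f x * w x)%:E)%E.
  apply: (dominated_cvg _ _ _ _ iMw) => //.
  - by move=> n; apply: measurable_int (iC _ (CF n)).
  - move=> x _; apply: cvg_EFin; first exact: nearW.
    by apply: cvgM; [exact: Ff|exact: cvg_cst].
  - move=> n x _; rewrite /= -EFinM lee_fin normrM ler_wpM2r//.
    by rewrite (le_trans (FM n x))// ler_norm.
have h2 : (\int[Q]_x (F n (neg x) * w x)%:E @[n --> \oo] --> \int[Q]_x (f (neg x) * w x)%:E)%E.
  apply: (dominated_cvg _ _ _ _ iMw) => //.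
  - by move=> n; apply: measurable_int (iCneg _ (CF n)).
  - move=> x _; apply: cvg_EFin; first exact: nearW.
    by apply: cvgM; [exact: Ff|exact: cvg_cst].
  - move=> n x _; rewrite /= -EFinM lee_fin normrM ler_wpM2r//.
    by rewrite (le_trans (FM n _))// ler_norm.
rewrite -(cvg_lim _ h1)// -(cvg_lim _ h2)//.
by congr (lim (_ @ \oo)); apply/funext => n; exact: IH.
Qed.

End weight.
End reflection.

Section reflection_invariance.
Context {R : realType} (Q : {measure set (bisequence R) -> \bar R}).
Local Notation neg := (dilateZ (-1 : R)).
Local Notation C := (bounded_closure (@trig_monomials R)).

(** Even, hence compatible with the reflection, and quadratic for small [x n], which makes the
    weighted measure finite. It vanishes only where [c * x n] is a multiple of 2 pi. *)
Definition cos_weight (n : int) (c : R) : bisequence R -> R :=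
  fun x => 1 - cos (c * x n).

Hypothesis i_cos_weight : forall n c,
  Q.-integrable setT (EFin \o cos_weight n c).
Hypothesis sin_cos_weight0 : forall n c N a,
  \int[Q]_x (sin (lform N a x) * cos_weight n c x) = 0.

Lemma measurable_cos_coord n c :
  measurable_fun setT (fun x : bisequence R => cos (c * x n)).
Proof.
apply: measurableT_comp; first exact: continuous_measurable_fun (@continuous_cos R).
by apply: measurable_funM => //; exact: measurable_coord.
Qed.

Lemma reflection_cos_neq1 n c (A : set (bisequence R)) : measurable A ->
  Q (A `&` [set x : bisequence R | cos (c * x n) != 1]) =
  Q (neg @^-1` A `&` [set x : bisequence R | cos (c * x n) != 1]).
Proof.
move=> mA; set E : set (bisequence R) := [set x | _].
have mE : measurable E.
  rewrite (_ : E = (fun x : bisequence R => cos (c * x n)) @^-1` (~` [set 1])).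
    rewrite -[X in measurable X]setTI; apply: measurable_cos_coord => //.
    exact: measurableC.
  by apply/seteqP; split=> x /= /eqP.
have mnegA : measurable (neg @^-1` A).
  by rewrite -[X in measurable X]setTI; exact: measurable_dilateZ.
(* The weight is 2 (1 - u); multiplied by the geometric sums of u it becomes
   1 - u^k, which increases to the indicator of E. *)
pose u (x : bisequence R) := (1 + cos (c * x n)) / 2.
have u0 x : 0 <= u x by have := cos_geN1 (c * x n); rewrite /u; lra.
have u1 x : u x <= 1 by have := cos_le1 (c * x n); rewrite /u; lra.
have mu : measurable_fun setT u.
  by apply: measurable_funM => //; apply: measurable_funD => //; exact: measurable_cos_coord.
have un x : u (neg x) = u x by rewrite /u /dilateZ mulN1r mulrN cosN.
have Cu : C u.
  rewrite (_ : u = fun x => 2^-1 * (1 + cos (c * x n))).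
    have [N [a aE]] := lform_coord n c.
    apply: (bclosureZ (@trig_monomials1 R)).
    apply: bclosureD; first exact: bclosure_cst (@trig_monomials1 R) 1.
    by apply: BClosureGen; exists N, a, 0; apply/funext => x; rewrite addr0 aE.
  by apply/funext => x; rewrite mulrC.
pose f k x := 2^-1 * (\1_A x * \sum_(i < k) u x ^+ i).
have Cf k : C (f k).
  apply: (bclosureZ (@trig_monomials1 R)).
  apply: (bclosureM (@trig_monomials_bounded R) (@trig_monomialsM R)).
    exact: trig_closure_indic.
  apply: (bclosure_sum (F := fun i x => u x ^+ i) (@trig_monomials1 R)) => i.
  exact: (bclosureX (@trig_monomials1 R) (@trig_monomials_bounded R) (@trig_monomialsM R)).
have fw k x : f k x * cos_weight n c x = \1_A x * (1 - u x ^+ k).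
  rewrite -[1 - u x ^+ k]opprB subrX1 -mulNr opprB /f /cos_weight.
  have -> : 1 - cos (c * x n) = 2 * (1 - u x) by rewrite /u; field.
  by field.
have lim_fw B : measurable B ->
    (\int[Q]_x (\1_B x * (1 - u x ^+ k))%:E @[k --> \oo] --> Q (B `&` E))%E.
  move=> mB.
  have -> : Q (B `&` E) = (\int[Q]_x lim ((\1_B x * (1 - u x ^+ k))%:E @[k --> \oo]))%E.
    rewrite -[B `&` E]setIT -integral_indic//; last exact: measurableI.
    apply: eq_integral => x _; apply/esym/cvg_lim => //.
    apply: cvg_EFin; first exact: nearW.
    rewrite indicI/= -[\1_E x]/(\1_E x : R).
    apply: cvgM; first exact: cvg_cst.
    rewrite indicE /E /=.
    have [/eqP h|h] := boolP (cos (c * x n) == 1).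
      rewrite memNset/= ?h ?eqxx//.
      apply: cvg_near_cst; apply: nearW => k.
      by rewrite /u h (_ : (1 + 1) / 2 = 1) ?expr1n ?subrr//; field.
    rewrite mem_set//= -[X in _ --> X]subr0; apply: cvgB; first exact: cvg_cst.
    apply: cvg_expr; rewrite ger0_norm//.
    have : cos (c * x n) < 1 by rewrite lt_neqAle h cos_le1.
    by rewrite /u; lra.
  apply: cvg_monotone_convergence => //.
  - move=> k; apply/measurable_EFinP; apply: measurable_funM => //.
    by apply: measurable_funB => //; exact: measurable_funX.
  - move=> k x _; rewrite lee_fin mulr_ge0// subr_ge0.
    exact: exprn_ile1.
  - move=> x _ k l kl; rewrite lee_fin ler_wpM2l// lerD2l lerN2.
    by rewrite ler_wiXn2l.
apply: (cvg_unique _ (lim_fw _ mA)) => //.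
rewrite (_ : (fun k => _) = (fun k => \int[Q]_x (\1_(neg @^-1` A) x * (1 - u x ^+ k))%:E)%E).
  exact: lim_fw.
apply/funext => k.
under eq_integral do rewrite -fw.
rewrite (integral_trig_closure_neg (i_cos_weight n c) (@sin_cos_weight0 n c) (Cf k)).
apply: eq_integral => x _; congr EFin; rewrite -[in RHS]un -(fw k (neg x)).
by rewrite /cos_weight /dilateZ mulN1r mulrN cosN.
Qed.

(** A single weight misses part of the space, but the frequencies 1/(k+1) on all coordinates miss
    only the zero sequence: for k > |x n| > 0 the modulus of the angle lies in ]0, pi[. The sets
    [E p] are symmetric, hence so are the disjoint pieces made from them, and the masses add up. *)
Lemma reflection_invariant (A : set (bisequence R)) :
  Q [set (fun=> 0)] = 0%E -> measurable A -> Q (neg @^-1` A) = Q A.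
Proof.
move=> Q0 mA.
pose E (p : int * nat) : set (bisequence R) := [set x | cos (p.2.+1%:R^-1 * x p.1) != 1].
pose F k := if unpickle k is Some p then E p else set0.
have mE p : measurable (E p).
  rewrite (_ : E p = (fun x : bisequence R => cos (p.2.+1%:R^-1 * x p.1)) @^-1` (~` [set 1])).
    rewrite -[X in measurable X]setTI; apply: measurable_cos_coord => //.
    exact: measurableC.
  by apply/seteqP; split=> x /= /eqP.
have mF k : measurable (F k) by rewrite /F; case: unpickle.
have cover : ~` [set (fun=> 0)] = \bigcup_k F k.
  apply/seteqP; split=> [x /= x0|x [k _]].
    have [n /eqP xn0] : exists n, x n <> 0.
      by apply/existsNP => h; apply: x0; apply/funext.
    pose k := Num.bound `|x n|.
    exists (pickle (n, k)) => //; rewrite /F pickleK /E/=.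
    have xk : `|k.+1%:R^-1 * x n| < pi.
      rewrite (lt_le_trans _ (pi_ge2 R))// normrM gtr0_norm// ltr_pdivrMl//.
      have xK : `|x n| < k%:R by exact: archi_boundP.
      rewrite (lt_le_trans xK)// (@le_trans _ _ k.+1%:R)//.
        by rewrite ler_nat.
      by rewrite ler_peMr// ler1n.
    apply/eqP; rewrite -cos_norm => cosx.
    have /eqP : `|k.+1%:R^-1 * x n| = 0.
      apply: cos_inj; rewrite ?in_itv/= ?normr_ge0 ?(ltW xk) ?lexx ?pi_ge0//.
      by rewrite cos0.
    by rewrite normr_eq0 mulf_eq0 (negbTE xn0) orbF invr_eq0 pnatr_eq0.
  rewrite /F; case: unpickle => // p; rewrite /E/= => + x0.
  by rewrite x0 mulr0 cos0 eqxx.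
have m0 : measurable [set (fun=> 0) : bisequence R].
  by rewrite -[X in measurable X]setCK cover; apply: measurableC; exact: bigcup_measurable.
have mneg B : measurable B -> measurable (neg @^-1` B).
  by move=> mB; rewrite -[X in measurable X]setTI; exact: measurable_dilateZ.
have negF k : neg @^-1` F k = F k.
  rewrite /F; case: unpickle => // -[n j]; apply/seteqP.
  by split=> x; rewrite /E/= /dilateZ mulN1r mulrN cosN.
have negD k : neg @^-1` seqDU F k = seqDU F k.
  apply/seteqP; rewrite /seqDU -bigcup_mkord.
  have neg1 i x : F i (neg x) = F i x by rewrite -[in RHS]negF.
  by split=> x [/= + nF]; rewrite neg1 => Fx; split=> // -[i ik]; rewrite ?neg1 => Fi;
    apply: nF; exists i; rewrite ?neg1.
have mD k : measurable (seqDU F k) by exact: seqDU_measurable.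
have QB B : measurable B -> Q B = (\sum_(k <oo) Q (B `&` seqDU F k))%E.
  move=> mB; have mBD k : measurable (B `&` seqDU F k) by exact: measurableI.
  rewrite -measure_semi_bigcup//; first last.
  - exact: bigcup_measurable.
  - exact/trivIset_setIl/trivIset_seqDU.
  rewrite (measureDI Q mB m0) [X in (_ + X)%E](_ : _ = 0%E) ?adde0.
    by rewrite -setI_bigcupr -seqDU_bigcup_eq -cover setDE.
  by apply: (subset_measure0 _ m0 _ Q0); [exact: measurableI|exact: subIsetr].
rewrite QB; last exact: mneg.
rewrite (QB A)//; apply: eq_eseriesr => k _.
rewrite -{1}negD -preimage_setI.
have sF : A `&` seqDU F k `<=` F k by apply: subset_trans (@subset_seqDU _ F k); exact: subIsetr.
have sF' : neg @^-1` (A `&` seqDU F k) `<=` F k by rewrite -[X in _ `<=` X]negF; exact: preimage_subset.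
have mDk := mD k; set D := seqDU F k in sF sF' mDk *.
have := erefl (F k); rewrite {2}/F; case: unpickle => [[n j]|] FE; last first.
  by move: sF; rewrite FE subset0 => ->; rewrite preimage_set0.
rewrite FE in sF sF'.
have := @reflection_cos_neq1 n j.+1%:R^-1 (A `&` D) (measurableI _ _ mA mDk).
by rewrite (setIidl sF) (setIidl sF') => ->.
Qed.

End reflection_invariance.

(** * The imaginary part of the Levy exponent *)

Section invariant_integral.
Context d (T : measurableType d) (R : realType) (mu : {measure set T -> \bar R}).
Variables (phi : T -> T) (f : T -> \bar R).
Hypothesis mphi : measurable_fun setT phi.
Hypothesis phi_inv : forall B, measurable B -> mu (phi @^-1` B) = mu B.
Hypothesis mf : measurable_fun setT f.

Lemma ge0_integral_invariant : (forall x, (0 <= f x)%E) ->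
  (\int[mu]_x f (phi x) = \int[mu]_x f x)%E.
Proof.
move=> f0; have := ge0_integral_pushforward mphi mu measurableT mf (fun x _ => f0 x).
rewrite preimage_setT => <-.
by apply: (eq_measure_integral mu) => A mA _; exact: phi_inv.
Qed.

Lemma integral_invariant : mu.-integrable setT (f \o phi) ->
  (\int[mu]_x f (phi x) = \int[mu]_x f x)%E.
Proof.
move=> fi; have := integral_pushforward mphi mf fi measurableT.
rewrite preimage_setT => <-.
by apply: (eq_measure_integral mu) => A mA _; exact: phi_inv.
Qed.

End invariant_integral.

Section trigonometric_bounds.
Context {R : realType}.

Let sin_MVT (x : R) : 0 <= x -> exists2 c, 0 <= c <= x & sin x = cos c * x.
Proof.
move=> x0; have [c cx h] := @MVT_segment R sin cos 0 x x0
  (fun y _ => is_derive_sin y) (continuous_subspaceT (@continuous_sin R)).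
exists c; first by move: cx; rewrite in_itv.
by move: h; rewrite sin0 !subr0.
Qed.

Lemma abs_sin_le (x : R) : `|sin x| <= `|x|.
Proof.
wlog x0 : x / 0 <= x.
  move=> h; have [|x0] := leP 0 x; first exact: h.
  by rewrite -normrN -sinN -(normrN x); apply: h; rewrite oppr_ge0 ltW.
have [c _ ->] := sin_MVT x0.
by rewrite normrM ler_piMl// cos_max.
Qed.

Lemma one_sub_cosE (x : R) : 1 - cos x = 2 * sin (x / 2) ^+ 2.
Proof.
rewrite {1}(splitr x) cosD -!expr2 cos2sin2; ring.
Qed.

Lemma one_sub_cos_le_sqr (x : R) : 1 - cos x <= x ^+ 2 / 2.
Proof.
rewrite one_sub_cosE.
have : sin (x / 2) ^+ 2 <= (x / 2) ^+ 2.
  by rewrite -[leLHS]real_normK ?num_real// -[leRHS]real_normK ?num_real// lerXn2r ?nnegrE// abs_sin_le.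
have -> : x ^+ 2 / 2 = 2 * (x / 2) ^+ 2 by field.
by rewrite ler_pM2l.
Qed.

Lemma abs_sin_sub_le (x : R) : `|sin x - x| <= x ^+ 2.
Proof.
wlog x0 : x / 0 <= x.
  move=> h; have [|x0] := leP 0 x; first exact: h.
  by rewrite -normrN opprD -sinN -sqrrN; apply: h; rewrite oppr_ge0 ltW.
have [c /andP[c0 cx] ->] := sin_MVT x0.
rewrite -{2}(mul1r x) -mulrBl normrM (ger0_norm x0) expr2 ler_wpM2r//.
rewrite ler0_norm ?subr_le0 ?cos_le1// opprB (le_trans _ cx)//.
have := one_sub_cos_le_sqr c; have := cos_geN1 c.
(* The bound c^2 / 2 is below c only up to c = 2; beyond, 1 - cos c <= 2 < c. *)
have [c2|c2] := leP c 2; last by lra.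
by move=> _ /le_trans; apply; nra.
Qed.

End trigonometric_bounds.

Section Levy_exponent.
Context {R : realType} {Q : {measure set (bisequence R) -> \bar R}}.
Hypothesis shiftQ : forall B : set (bisequence R), measurable B ->
  Q ((@shiftZ R) @^-1` B) = Q B.
Hypothesis intQ : (\int[Q]_x (Num.min ((x : int -> R) 0 ^+ 2) 1)%:E < +oo)%E.

Definition sqr_min1 (n : int) (x : int -> R) : R := Num.min (x n ^+ 2) 1.

Let sqr_min1_ge0 n x : 0 <= sqr_min1 n x.
Proof. by rewrite le_min sqr_ge0/=. Qed.

Let measurable_sqr_min1 n : measurable_fun setT (sqr_min1 n : bisequence R -> R).
Proof.
apply: measurable_minr => //; apply: measurable_funX.
exact: measurable_coord.
Qed.

Let integral_shift n :
  (\int[Q]_x (sqr_min1 (n + 1) x)%:E = \int[Q]_x (sqr_min1 n x)%:E)%E.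
Proof.
have mf : measurable_fun setT (EFin \o (sqr_min1 n : bisequence R -> R)).
  exact/measurable_EFinP.
rewrite -(ge0_integral_invariant measurable_shiftZ shiftQ mf)// => x.
by rewrite lee_fin sqr_min1_ge0.
Qed.

Lemma integral_sqr_min1 n :
  (\int[Q]_x (sqr_min1 n x)%:E = \int[Q]_x (sqr_min1 0 x)%:E)%E.
Proof.
case: n => k; elim: k => [//|k IH]; first by rewrite -addn1 PoszD integral_shift.
  by rewrite -integral_shift.
rewrite -IH -(integral_shift (Negz k.+1)).
by have -> : Negz k.+1 + 1 = Negz k by rewrite !NegzE -[k.+2]addn1 PoszD opprD subrK.
Qed.

Lemma integrable_sqr_min1 n : Q.-integrable setT (EFin \o (sqr_min1 n : bisequence R -> R)).
Proof.
apply/integrableP; split; first exact/measurable_EFinP.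
under eq_integral do rewrite /= ger0_norm//.
by rewrite integral_sqr_min1.
Qed.

Let measurable_truncation : measurable_fun setT (@truncation R).
Proof.
apply: measurable_fun_if => //; first exact: measurable_fun_ltr.
apply: measurable_funTS; apply: measurable_fun_ifT => //.
exact: measurable_fun_ler.
Qed.

Lemma integrable_cos_weight n c : Q.-integrable setT (EFin \o cos_weight n c).
Proof.
(* The constant covers the quadratic bound where |x n| <= 1 and the trivial bound 2 elsewhere. *)
apply: (@le_integrable _ _ _ _ _ measurableT _ (fun x : bisequence R => (c ^+ 2 + 2)%:E * (sqr_min1 n x)%:E)%E).
- apply/measurable_EFinP; apply: measurable_funB => //; exact: measurable_cos_coord.
- move=> x _; rewrite -EFinM/= lee_fin/= /cos_weight ger0_norm ?subr_ge0 ?cos_le1//.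
  rewrite ger0_norm; last by rewrite mulr_ge0// addr_ge0// sqr_ge0.
  have := one_sub_cos_le_sqr (c * x n); have := cos_geN1 (c * x n).
  have := sqr_ge0 c; have := sqr_ge0 (x n); rewrite /sqr_min1 exprMn.
  by case: (leP (x n ^+ 2) 1) => h; nra.
- by apply: integrableZl => //; exact: integrable_sqr_min1.
Qed.

(** The imaginary part of the integrand in the Levy-Khintchine exponent. *)
Definition sin_compensated N (a x : int -> R) : R :=
  sin (lform N a x) - lform N a (fun n => truncation (x n)).

Lemma abs_truncation (t : R) : truncation t ^+ 2 = Num.min (t ^+ 2) 1.
Proof.
rewrite /truncation; case: ifPn => [t1|]; last rewrite -leNgt => t1.
  by rewrite min_r ?sqrrN ?expr1n//; nra.
case: ifPn => [t2|]; last rewrite -ltNge => t2.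
  by rewrite min_l//; nra.
by rewrite min_r ?expr1n//; nra.
Qed.

Let S N x : R := \sum_(i < N) (sqr_min1 (Posz i) x + sqr_min1 (Negz i) x).
Let A N (a : int -> R) : R := \sum_(i < N) (`|a (Posz i)| + `|a (Negz i)|).

Let S_ge0 N x : 0 <= S N x.
Proof. by apply: sumr_ge0 => i _; rewrite addr_ge0. Qed.

Let A_ge0 N a : 0 <= A N a.
Proof. by apply: sumr_ge0 => i _; rewrite addr_ge0. Qed.

Let S_ge N x (i : 'I_N) : sqr_min1 (Posz i) x <= S N x /\ sqr_min1 (Negz i) x <= S N x.
Proof.
rewrite /S (bigD1 i)//= -addrA; set r := \sum_(_ | _) _.
have r0 : 0 <= r by apply: sumr_ge0 => j _; rewrite addr_ge0.
by split; [rewrite lerDl addr_ge0|rewrite addrCA lerDl addr_ge0].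
Qed.

(** Let u be the form at the truncated coordinates. The sines of the form and of u differ only if
    some coordinate is truncated, and then [S N x] is at least 1; the rest, sin u - u, is at most
    u^2, and Cauchy-Schwarz-free bounds |truncation (x n)| <= sqrt (S N x) give u^2 <= A^2 S. *)
Lemma abs_sin_compensated N a x :
  `|sin_compensated N a x| <= (2 + A N a ^+ 2) * S N x.
Proof.
set u := lform N a (fun n => truncation (x n)).
have h2 : `|sin u - u| <= A N a ^+ 2 * S N x.
  rewrite (le_trans (abs_sin_sub_le _))//.
  rewrite -[S N x]sqr_sqrtr ?S_ge0// -exprMn -[leLHS]real_normK ?num_real//.
  rewrite lerXn2r ?nnegrE ?mulr_ge0 ?sqrtr_ge0//.
  rewrite mulr_suml (le_trans (ler_norm_sum _ _ _))// ler_sum// => i _.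
  rewrite (le_trans (ler_normD _ _))// mulrDl !normrM.
  have [h1 h2] := S_ge x i.
  by rewrite lerD// ler_wpM2l// -sqrtr_sqr ler_wsqrtr// abs_truncation.
have h1 : `|sin (lform N a x) - sin u| <= 2 * S N x.
  have [S1|S1] := leP 1 (S N x).
    rewrite (le_trans (ler_normB _ _))//.
    by have := sin_max (lform N a x); have := sin_max u; lra.
  suff -> : lform N a x = u by rewrite subrr normr0 mulr_ge0.
  have trid n : sqr_min1 n x <= S N x -> truncation (x n) = x n.
    move=> /le_lt_trans/(_ S1); rewrite /sqr_min1 gt_min ltxx orbF => xn1.
    have : `|x n| < 1 by rewrite -(@expr_lt1 _ 2)// real_normK ?num_real.
    by rewrite ltr_norml => /andP[x1 x2]; rewrite /truncation ltNge (ltW x1)/= (ltW x2).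
  by apply: eq_bigr => i _; have [? ?] := S_ge x i; rewrite !trid.
rewrite /sin_compensated -/u -(subrKA (sin u)) (le_trans (ler_normD _ _))//.
by rewrite mulrDl lerD.
Qed.

Let integrable_S N : Q.-integrable setT (EFin \o (S N : bisequence R -> R)).
Proof.
rewrite (_ : _ \o _ = (fun x => \sum_(i < N) ((sqr_min1 (Posz i) x)%:E + (sqr_min1 (Negz i) x)%:E)))%E.
  by apply: integrable_sum => // i _; apply: integrableD => //; exact: integrable_sqr_min1.
by apply/funext => x; rewrite /= /S -sumEFin; apply: eq_bigr => i _; rewrite EFinD.
Qed.

Lemma measurable_sin_compensated N a :
  measurable_fun setT (sin_compensated N a : bisequence R -> R).
Proof.
apply: measurable_funB.
  apply: measurableT_comp; first exact: continuous_measurable_fun (@continuous_sin R).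
  exact: measurable_lform.
apply: (measurableT_comp (measurable_lform N a)
  (_ : measurable_fun setT (fun x : bisequence R => (fun n => truncation (x n)) : bisequence R))).
apply: measurable_bisequence => n; apply: measurableT_comp => //.
exact: measurable_coord.
Qed.

Lemma integrable_sin_compensated N a :
  Q.-integrable setT (EFin \o (sin_compensated N a : bisequence R -> R)).
Proof.
apply: (@le_integrable _ _ _ _ _ measurableT _ (fun x : bisequence R => (2 + A N a ^+ 2)%:E * (S N x)%:E)%E).
- by apply/measurable_EFinP; exact: measurable_sin_compensated.
- move=> x _; rewrite -EFinM/= lee_fin/=.
  have h0 : 0 <= (2 + A N a ^+ 2) * S N x by rewrite mulr_ge0 ?addr_ge0 ?sqr_ge0.
  by rewrite (ger0_norm h0); exact: abs_sin_compensated.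
- by apply: integrableZl => //; exact: integrable_S.
Qed.

Hypothesis sin_exponent0 : forall N a,
  sin (\int[Q]_x sin_compensated N a x) = 0.

(** One inequality is enough, as passing from [a] to [- a] changes the sign of the integral. The
    value is followed along the segment from 0 to [a]. *)
Let exponent_im_le0 N a : \int[Q]_x sin_compensated N a x <= 0.
Proof.
pose th (s : R) := \int[Q]_x sin_compensated N (fun n => s * a n) x.
have th0 : th 0 = 0.
  rewrite /th (_ : Rintegral _ _ _ = \int[Q]_x (0 : R)).
    by rewrite /Rintegral integral0.
  apply: eq_Rintegral => x _; rewrite /sin_compensated !lform_scale !mul0r.
  by rewrite sin0 subr0.
have th1 : th 1 = \int[Q]_x sin_compensated N a x.
  by rewrite /th; apply: eq_Rintegral => x _; rewrite /sin_compensated !lform_scale !mul1r.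
(* An open interval around [0, 1] on which the coefficients are at most 2 |a n|, which gives a
   dominating function uniform in [s]. *)
have cth : {in `]-2, 2[%classic, continuous th}.
  apply: (@continuity_under_integral R _ _ Q (fun s x => sin_compensated N (fun n => s * a n) x)
    setT measurableT (-2) 2 _ _ (fun x => (2 + (2 * A N a) ^+ 2) * S N x)).
  - by move=> s _; exact: integrable_sin_compensated.
  - apply: aeW => x _ s _.
    have cl y : continuous (fun s : R => lform N (fun n => s * a n) y).
      by under eq_fun do rewrite lform_scale; move=> t; exact: mulrr_continuous.
    apply: cvgB; last exact: cl.
    by apply: continuous_comp; [exact: cl|exact: continuous_sin].
  - rewrite (_ : _ \o _ = fun x => (2 + (2 * A N a) ^+ 2)%:E * (S N x)%:E)%E//.
    by apply: integrableZl => //; exact: integrable_S.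
  - move=> s /= s2; apply: aeW => x _; rewrite (le_trans (abs_sin_compensated _ _ _))//.
    rewrite ler_wpM2r// lerD2l lerXn2r ?nnegrE// ?mulr_ge0//.
    rewrite /A mulr_sumr ler_sum// => i _; rewrite !normrM -mulrDr ler_wpM2r ?addr_ge0//.
    by move: s2; rewrite /= in_itv/= ler_norml => /andP[? ?]; apply/andP; split; exact: ltW.
rewrite -th1 leNgt; apply/negP => th1_gt0.
have cth01 : {within `[0, 1], continuous th}.
  apply: continuous_in_subspaceT => s /set_mem /=; rewrite in_itv/= => /andP[s0 s1].
  by apply: cth; rewrite inE/= in_itv/=; apply/andP; split; lra.
(* Capping at 1 < pi yields a value in ]0, pi[, where the sine cannot vanish. *)
have [s _ ths] : exists2 s, s \in `[0, 1] & th s = Num.min (th 1) 1.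
  apply: (IVT ler01 cth01).
  by rewrite th0 (min_l (ltW th1_gt0)) (max_r (ltW th1_gt0)) ge_min lexx le_min ler01 (ltW th1_gt0).
have := sin_exponent0 N (fun n => s * a n).
rewrite -/(th s) ths; apply/eqP; rewrite gt_eqF//; apply: sin_gt0_pi.
rewrite lt_min th1_gt0 ltr01/=.
by rewrite (le_lt_trans (_ : _ <= 1))// ?ge_min ?lexx ?orbT// (lt_le_trans _ (pi_ge2 R))// ltr1n.
Qed.

Lemma exponent_im0 N a : \int[Q]_x sin_compensated N a x = 0.
Proof.
apply/eqP; rewrite eq_le exponent_im_le0/=.
have := exponent_im_le0 N (fun n => -1 * a n).
rewrite (_ : Rintegral _ _ _ = \int[Q]_x (-1 * sin_compensated N a x)).
  by rewrite RintegralZl ?mulN1r ?oppr_le0//; exact: integrable_sin_compensated.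
by apply: eq_Rintegral => x _; rewrite /sin_compensated !lform_scale !mulN1r sinN opprB opprK addrC.
Qed.

(** sin u (1 - cos v) = sin u - (sin (u + v) + sin (u - v)) / 2, and the compensators cancel in this
    combination because they are linear in the coefficients. Three vanishing exponents remain. *)
Lemma integral_sin_cos_weight n c N a :
  \int[Q]_x (sin (lform N a x) * cos_weight n c x) = 0.
Proof.
have [M [h hE]] := lform_coord n c.
have [p pE] := lform_lin N M 1 a h; have [m mE] := lform_lin N M (-1) a h.
rewrite (_ : Rintegral _ _ _ = \int[Q]_x (sin_compensated N a x -
  (2^-1 * sin_compensated (N + M) p x + 2^-1 * sin_compensated (N + M) m x))); last first.
  apply: eq_Rintegral => x _; rewrite /sin_compensated !pE !mE !mul1r !mulN1r hE.
  by rewrite sinD sinB /cos_weight; field.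
have iZ k b : Q.-integrable setT (EFin \o (fun x : bisequence R => 2^-1 * sin_compensated k b x)).
  rewrite (_ : _ \o _ = fun x => (2^-1)%:E * (sin_compensated k b x)%:E)%E//.
  by apply: integrableZl => //; exact: integrable_sin_compensated.
rewrite RintegralB//; [|exact: integrable_sin_compensated|].
  rewrite (RintegralD measurableT (iZ _ _) (iZ _ _)).
  rewrite !(RintegralZl _ measurableT (integrable_sin_compensated _ _)).
  by rewrite !exponent_im0 mulr0 addr0 subr0.
exact: (integrableD measurableT (iZ (N + M)%N p) (iZ (N + M)%N m)).
Qed.

End Levy_exponent.

(** * From the symmetry of the process to the symmetry of its Levy measure *)

Section Levy_measure_symmetric.
Context {R : realType} {d : measure_display} {W : measurableType d}.
Variables (P : probability W R) (Y : {RV P >-> bisequence R}).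
Variable Q : {sigma_finite_measure set (bisequence R) -> \bar R}.
Hypothesis YQ : is_Levy_measure P Y Q.
Hypothesis Y_symmetric : symmetric_process P Y.

Lemma symmetric_sin_expectation0 N a : \int[P]_w sin (lform N a (Y w)) = 0.
Proof.
pose g : bisequence R -> R := fun x => sin (lform N a x).
have mg : measurable_fun setT (EFin \o g).
  apply/measurable_EFinP; apply: measurableT_comp; last exact: measurable_lform.
  exact: continuous_measurable_fun (@continuous_sin R).
pose D := distribution P Y.
have ig (h : bisequence R -> R) : measurable_fun setT (EFin \o h) -> (forall x, `|h x| <= 1) ->
    D.-integrable setT (EFin \o h).
  move=> mh h1; apply: (@le_integrable _ _ _ _ _ measurableT _ (fun=> 1%E)) => //.
    by move=> x _; rewrite /= normr1 lee_fin.
  exact: finite_measure_integrable_cst.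
have mneg := @measurable_dilateZ R (-1).
have igneg : D.-integrable setT (EFin \o (fun x => g (dilateZ (-1) x))).
  by apply: ig; [exact: measurableT_comp mg mneg|move=> x; exact: sin_max].
have gD : (\int[D]_x (g x)%:E = 0)%E.
  have iD := ig g mg (fun x => sin_max _).
  have := integral_invariant mneg Y_symmetric mg igneg; rewrite /= -/D.
  have -> : (\int[D]_x (g (dilateZ (-1) x))%:E = (-1)%:E * \int[D]_x (g x)%:E)%E.
    rewrite -integralZl//; apply: eq_integral => x _.
    by rewrite /g /dilateZ lform_dilate mulN1r sinN -EFinM mulN1r.
  have := integrable_fin_num measurableT iD; case: (integral _ _ _) => // r _.
  by rewrite -EFinM mulN1r => -[rr]; congr EFin; lra.
have iP : P.-integrable setT ((EFin \o g) \o Y).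
  apply: (@le_integrable _ _ _ _ _ measurableT _ (fun=> 1%E)) => //.
  - exact: measurableT_comp.
  - by move=> x _; rewrite /= normr1 lee_fin sin_max.
  - exact: finite_measure_integrable_cst.
have := integral_pushforward (measurable_funPT Y) mg iP measurableT.
rewrite preimage_setT => h.
by rewrite /Rintegral -[X in fine X]h [X in fine X]gD.
Qed.

(** The imaginary part of the characteristic function is a positive exponential times this sine, and
    it is zero by symmetry of the process. *)
Lemma sin_Levy_exponent0 N a : sin (\int[Q]_x sin_compensated N a x) = 0.
Proof.
(* The form with [N = 0] is not one of the windows of [lincomb_lform]; one padding step reaches
   [N.+1]. *)
have [b bE] := lform_widen N 1 a.
have -> : \int[Q]_x sin_compensated N a x = \int[Q]_x sin_compensated N.+1 b x.
  by apply: eq_Rintegral => x _; rewrite /sin_compensated -bE addn1.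
have := congr1 (fun z => complex.Im z) (levy_khintchine YQ (n1 := Negz N) (n2 := Posz N) b isT).
rewrite /cintegral /=.
have -> : \int[P]_w (expR 0 * sin (lincomb (Negz N) N b (Y w))) = 0.
  rewrite -[RHS](symmetric_sin_expectation0 N.+1 b); apply: eq_Rintegral => w _.
  by rewrite expR0 mul1r lincomb_lform.
move=> /esym/eqP; rewrite mulf_eq0 gt_eqF ?expR_gt0//= => /eqP h.
rewrite -[RHS]h; congr sin; apply: eq_Rintegral => x _.
by rewrite /sin_compensated !lincomb_lform expR0 mul1r subr0.
Qed.

Lemma Levy_measure_symmetric (A : set (bisequence R)) : measurable A ->
  Q (dilateZ (-1) @^-1` A) = Q A.
Proof.
move=> mA; have [sQ Q0 iQ _] := YQ.
apply: reflection_invariant => //.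
- by move=> n c; exact: integrable_cos_weight.
- by move=> n c N a; apply: integral_sin_cos_weight => //; exact: sin_Levy_exponent0.
Qed.

End Levy_measure_symmetric.

(** * Polar coordinates *)

Section radial_measure_theory.
Context {R : realType} (alpha : R).
Hypothesis alpha_gt0 : 0 < alpha.
Local Notation radial := (radial_measure alpha).
Local Notation leb := (@lebesgue_measure R).

Let density (s : R) : R := `|s| `^ (- (1 + alpha)).

Let measurable_density : measurable_fun setT density.
Proof. exact: (measurableT_comp (measurable_powR _)). Qed.

Lemma radial_measure_set1 (r : R) : radial [set r] = 0%E.
Proof. exact: integral_set1. Qed.

Lemma radial_measureN (A : set R) : measurable A ->
  radial (-%R @^-1` A) = radial A.
Proof.
move=> mA; have mf : measurable_fun A (EFin \o density).
  by apply/measurable_EFinP/measurable_funTS.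
rewrite /radial_measure [LHS](_ : _ = (\int[leb]_(s in (-%R : _ -> measurableTypeR R) @^-1` A)
    ((EFin \o density) \o (-%R : _ -> measurableTypeR R)) s)%E).
  rewrite -ge0_integral_pushforward//=.
    by apply: eq_measure_integral => //= B mB _; exact: lebesgue_measureN.
  by move=> s _; rewrite lee_fin powR_ge0.
by apply: eq_integral => s _; rewrite /= /density normrN.
Qed.

Let powR_cvg0y : x `^ (- alpha) @[x --> +oo] --> (0 : R).
Proof.
apply/cvgrPdist_le => e e0; near=> x.
have x0 : 0 < x by near: x; exact: nbhs_pinfty_gt.
rewrite sub0r normrN ger0_norm ?powR_ge0// powRN.
rewrite invf_ple ?posrE ?powR_gt0//.
have h : e^-1 `^ alpha^-1 <= x by near: x; exact: nbhs_pinfty_ge.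
have -> : e^-1 = (e^-1 `^ alpha^-1) `^ alpha.
  by rewrite -powRrM mulVf ?gt_eqF// powRr1// invr_ge0 ltW.
by rewrite ge0_ler_powR ?nnegrE ?powR_ge0 ?ltW.
Unshelve. all: by end_near. Qed.

Lemma radial_measure_gt (r : R) : 0 < r ->
  radial `]r, +oo[%classic = (r `^ (- alpha) / alpha)%:E.
Proof.
move=> r0.
have pos x : x \in `]r, +oo[ -> 0 < x by rewrite in_itv/= andbT; exact: lt_trans.
pose F (x : R) := - alpha^-1 * x `^ (- alpha).
have dF (x : R) : 0 < x -> is_derive x 1 F (density x).
  move=> x0; have := is_derive1_powR (- alpha) x0 => h.
  have hz := is_deriveZ (- alpha^-1) h.
  apply: (is_derive_eq hz).
  rewrite /density gtr0_norm// opprD [- 1 + _]addrC /GRing.scale/=.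
  by rewrite mulrA mulrNN mulVf ?gt_eqF// mul1r.
have cF (x : R) : 0 < x -> {for x, continuous F}.
  move=> x0; apply/differentiable_continuous/derivable1_diffP.
  by case: (dF x x0).
have cd (x : R) : 0 < x -> {for x, continuous density}.
  move=> x0; have nx0 : 0 < `|x| by rewrite normr_gt0 gt_eqF.
  have c1 : {for `|x|, continuous (fun y : R => y `^ (- (1 + alpha)))}.
    apply/differentiable_continuous/derivable1_diffP.
    by case: (is_derive1_powR (- (1 + alpha)) nx0).
  have c2 : {for x, continuous (fun y : R => `|y|)} by exact: norm_continuous.
  exact: (continuous_comp c2 c1).
rewrite /radial_measure integral_itv_obnd_cbnd; last first.
  exact/measurable_EFinP/measurable_funTS.
rewrite (@ge0_continuous_FTC2y R density F r 0).
- by rewrite sub0e /F -EFinN mulNr opprK mulrC.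
- by move=> x _; exact: powR_ge0.
- apply/continuous_within_itvcyP; split; first by move=> x /pos; exact: cd.
  by apply: cvg_at_right_filter; exact: cd.
- by rewrite -[0](mulr0 (- alpha^-1)); apply: cvgM; [exact: cvg_cst|exact: powR_cvg0y].
- by move=> x rx; case: (dF x (lt_trans r0 rx)).
- by apply: cvg_at_right_filter; exact: cF.
- by move=> x /pos x0; rewrite derive1E; case: (dF x x0).
Qed.

Lemma radial_measure_lt (r : R) : 0 < r ->
  radial `]-oo, (- r)%R[%classic = (r `^ (- alpha) / alpha)%:E.
Proof.
move=> r0; rewrite -radial_measure_gt// -[RHS]radial_measureN//; congr (radial _).
by apply/seteqP; split=> x; rewrite /= !in_itv/= andbT ltrNr.
Qed.

Lemma radial_measure_norm_gt (r : R) : 0 < r ->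
  radial [set s | r < `|s|] = (2 / alpha * r `^ (- alpha))%:E.
Proof.
move=> r0.
have -> : [set s | r < `|s|] = `]r, +oo[%classic `|` `]-oo, (- r)%R[%classic.
  apply/seteqP; split=> s; rewrite /= !in_itv/= andbT.
    by rewrite ltr_normr => /orP[|]; [left|right; rewrite ltrNr].
  by rewrite ltr_normr => -[->//|]; rewrite ltrNr => ->; rewrite orbT.
rewrite measureU//=.
  rewrite [X in (X + _)%E](radial_measure_gt r0) [X in (_ + X)%E](radial_measure_lt r0).
  by rewrite -EFinD; congr EFin; field; rewrite gt_eqF.
rewrite -subset0 => s [/=]; rewrite !in_itv/= andbT => rs sr.
by have := lt_trans rs sr; lra.
Qed.

End radial_measure_theory.

Section borel_rays.
Context {R : realType}.

(** A pi-system adapted to the radial measure, which is infinite near 0: its rays stay away from 0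
    and have finite mass, and the singleton is there to cover 0. *)
Definition signed_rays : set (set R) :=
  [set A | [\/ A = set0, A = [set 0],
    (exists2 r, 0 < r & A = `]r, +oo[%classic) |
    exists2 r, 0 < r & A = `]-oo, (- r)%R[%classic]].

Lemma signed_rays_setI : setI_closed signed_rays.
Proof.
have s0 : signed_rays set0 by apply: Or41.
have h0 r : 0 < r -> [set 0] `&` `]r, +oo[%classic = set0 :> set R.
  move=> r0; rewrite -subset0 => s [->] /=; rewrite in_itv/= andbT.
  by move=> /(lt_trans r0); rewrite ltxx.
have h1 r : 0 < r -> [set 0] `&` `]-oo, (- r)%R[%classic = set0 :> set R.
  move=> r0; rewrite -subset0 => s [->] /=; rewrite in_itv/= oppr_gt0.
  by move=> /(lt_trans r0); rewrite ltxx.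
have h2 r s : 0 < r -> 0 < s -> `]r, +oo[%classic `&` `]-oo, (- s)%R[%classic = set0 :> set R.
  move=> r0 s0'; rewrite -subset0 => x []/=; rewrite !in_itv/= andbT => rx xs.
  by have := lt_trans rx xs; lra.
move=> _ B [->|->|[r r0 ->]|[r r0 ->]].
- by rewrite set0I.
- move=> [->|->|[s s0' ->]|[s s0' ->]]; rewrite ?setI0 ?setIid ?h0 ?h1//.
  exact: Or42.
- move=> [->|->|[s s0' ->]|[s s0' ->]]; rewrite ?setI0 ?h2// ?(setIC _ [set 0]) ?h0//.
  apply: Or43; exists (Num.max r s); first by rewrite lt_max r0.
  by apply/seteqP; split=> x; rewrite /= !in_itv/= !andbT gt_max => /andP.
- move=> [->|->|[s s0' ->]|[s s0' ->]]; rewrite ?setI0// 1?(setIC _ [set 0]) ?h1//.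
    by rewrite setIC h2.
  apply: Or44; exists (Num.max r s); first by rewrite lt_max r0.
  have e x : (x < - Num.max r s) = (x < - r) && (x < - s).
    by rewrite ltrNr gt_max (ltrNr r) (ltrNr s).
  by apply/seteqP; split=> x; rewrite /= !in_itv/= e => /andP.
Qed.

Lemma measurable_signed_rays : @measurable _ R = <<s signed_rays >>.
Proof.
apply/seteqP; split; last first.
  apply: smallest_sub; first exact: sigma_algebra_measurable.
  by move=> _ [->|->|[r r0 ->]|[r r0 ->]].
suff : <<s @RGenOInfty.G R >> `<=` <<s signed_rays >>.
  have E : @measurable _ R = <<s @RGenOInfty.G R >> := RGenOInfty.measurableE R.
  by rewrite -E.
apply: smallest_sub; first exact: smallest_sigma_algebra.
have s_ A : signed_rays A -> <<s signed_rays >> A by move=> ?; exact: sub_sigma_algebra.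
have sU (F : (set R)^nat) : (forall k, <<s signed_rays >> (F k)) -> <<s signed_rays >> (\bigcup_k F k).
  by move=> sF; apply: sigma_algebra_bigcup.
have sC (A : set R) : <<s signed_rays >> A -> <<s signed_rays >> (~` A).
  by move=> sA; rewrite -setTD; apply: sigma_algebraCD.
have inv0 k : 0 < k.+1%:R^-1 :> R by [].
have inv_lt (e : R) : 0 < e -> exists k, k.+1%:R^-1 < e.
  move=> e0; exists (Num.bound e^-1).
  rewrite invf_plt ?posrE// (lt_le_trans (archi_boundP _))// ?invr_ge0 ?(ltW e0)//.
  by rewrite ler_nat.
move=> _ [a ->]; have [a0|a0|->] := ltgtP a 0; first last.
- rewrite (_ : `]0, +oo[%classic = \bigcup_k `](k.+1%:R^-1 : R), +oo[%classic).
    by apply: sU => k; apply: s_; apply: Or43; exists k.+1%:R^-1.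
  apply/seteqP; split=> x /=; rewrite in_itv/= andbT.
    by move=> /inv_lt[k xk]; exists k => //=; rewrite in_itv/= andbT.
  by move=> [k _] /=; rewrite in_itv/= andbT; exact: lt_trans.
- by apply: s_; apply: Or43; exists a.
(* The endpoints a / (1 + 1/(k+1)) decrease to [a] and stay negative, so each set in the union is
   the complement of a signed ray. *)
- rewrite (_ : `]a, +oo[%classic = ~` ~` \bigcup_k ~` `]-oo, - (- a / (1 + k.+1%:R^-1))[%classic).
    apply: (sC); apply: (sC); apply: (sU) => k; apply: (sC); apply: (s_); apply: Or44.
    exists (- a / (1 + k.+1%:R^-1)) => //.
    by rewrite divr_gt0 ?oppr_gt0// addr_gt0.
  rewrite setCK; apply/seteqP; split=> x /=; rewrite in_itv/= andbT.
    move=> ax.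
    have [x0|x0] := leP 0 x.
      exists 0%N => //=; rewrite in_itv/=; apply/negP; rewrite -leNgt.
      by rewrite (le_trans _ x0)// oppr_le0 divr_ge0 ?oppr_ge0 ?ltW// addr_gt0.
    have : 0 < a / x - 1.
      by rewrite subr_gt0 ltr_ndivlMr// mul1r.
    move=> /inv_lt[k xk]; exists k => //=; rewrite in_itv/=; apply/negP; rewrite -leNgt.
    rewrite -mulNr opprK ler_pdivrMr ?addr_gt0//.
    have : k.+1%:R^-1 + 1 < a / x by rewrite -ltrBrDr.
    by rewrite ltr_ndivlMr// mulrC addrC => /ltW.
  move=> [k _] /=; rewrite in_itv/= => /negP; rewrite -leNgt.
  rewrite -mulNr opprK; apply: lt_le_trans.
  rewrite ltr_pdivlMr ?addr_gt0// mulrDr mulr1 gtrDl.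
  by rewrite nmulr_rlt0.
Qed.

End borel_rays.

(** * Signed homogeneous gauges *)

Section homogeneous_gauge.
Context {R : realType}.

(** Only surjectivity onto Z matters; an index that encodes no integer repeats coordinate 0. *)
Definition intenum (k : nat) : int := odflt 0 (unpickle k).

Let leading (k : nat) : set (bisequence R) :=
  [set x | x (intenum k) != 0 /\ forall j, (j < k)%N -> x (intenum j) = 0].

Variable w : nat -> R.
Hypothesis w_gt0 : forall k, 0 < w k.

(** Which coordinate comes first among the nonzero ones does not change under dilation by a nonzero
    scalar of either sign, so homogeneity holds with sign. *)
Definition gauge (x : bisequence R) : R :=
  if pselect (exists k, x (intenum k) != 0) is left h
  then w (ex_minn h) * x (intenum (ex_minn h)) else 0.

Let gaugeP x : (x = fun=> 0) /\ gauge x = 0 \/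
  exists2 k, leading k x & gauge x = w k * x (intenum k).
Proof.
rewrite /gauge; case: pselect => [h|h].
  right; exists (ex_minn h) => //; case: ex_minnP => k xk kmin; split=> // j jk.
  by apply/eqP; apply: contraTT jk => /kmin; rewrite -leqNgt.
left; split=> //; apply/funext => n; apply/eqP; apply: contra_notT h => xn.
by exists (pickle n); rewrite /intenum pickleK.
Qed.

Let gauge_leading k x : leading k x -> gauge x = w k * x (intenum k).
Proof.
move=> [xk kmin]; have [[x0 _]|[j [xj jmin] ->]] := gaugeP x.
  by move: xk; rewrite x0 eqxx.
have [jk|kj|->//] := ltngtP j k.
  by move: xj; rewrite kmin ?eqxx.
by move: xk; rewrite jmin ?eqxx.
Qed.

Lemma gauge_eq0 x : gauge x = 0 -> x = fun=> 0.
Proof.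
have [[]//|[k [xk _] ->]] := gaugeP x.
by move=> /eqP; rewrite mulf_eq0 (negbTE xk) gt_eqF.
Qed.

Lemma gauge0 : gauge (fun=> 0) = 0.
Proof. by have [[]//|[k [/eqP]]] := gaugeP (fun=> 0). Qed.

Lemma gauge_dilateZ t x : gauge (dilateZ t x) = t * gauge x.
Proof.
have [->|t0] := eqVneq t 0.
  rewrite mul0r (_ : dilateZ 0 x = fun=> 0) ?gauge0//.
  by apply/funext => n; rewrite /dilateZ mul0r.
have [[-> g0]|[k [xk kmin] ->]] := gaugeP x.
  rewrite g0 mulr0 (_ : dilateZ t (fun=> 0) = fun=> 0) ?gauge0//.
  by apply/funext => n; rewrite /dilateZ mulr0.
rewrite (@gauge_leading k); first by rewrite /dilateZ mulrCA.
split; first by rewrite /dilateZ mulf_neq0.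
by move=> j /kmin xj; rewrite /dilateZ xj mulr0.
Qed.

Lemma measurable_gauge : measurable_fun setT gauge.
Proof.
have mz n : measurable [set x : bisequence R | x n = 0].
  by rewrite -[X in measurable X]setTI; exact: (measurable_coord n measurableT (measurable_set1 0)).
have mL k : measurable (leading k).
  rewrite (_ : leading k = (~` [set x : bisequence R | x (intenum k) = 0]) `&`
      \bigcap_(j in `I_k) [set x : bisequence R | x (intenum j) = 0]).
    by apply: measurableI; [exact: measurableC|exact: bigcap_measurableType].
  by apply/seteqP; split=> x [/= /eqP xk h].
move=> _ B mB; rewrite setTI.
rewrite (_ : gauge @^-1` B = \bigcup_k (leading k `&` (fun x : bisequence R => w k * x (intenum k)) @^-1` B)
   `|` (if `[< B 0 >] then \bigcap_k [set x : bisequence R | x (intenum k) = 0] else set0)).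
  apply: measurableU.
    apply: bigcup_measurable => k _; apply: measurableI => //.
    have mk : measurable_fun setT (fun x : bisequence R => w k * x (intenum k)).
      by apply: measurable_funM => //; exact: measurable_coord.
    by rewrite -[X in measurable X]setTI; exact: mk.
  by case: ifP => // _; exact: bigcap_measurableType.
apply/seteqP; split=> x /=.
  have [[x0 ->]|[k xk ->]] := gaugeP x; last by left; exists k.
  by move=> B0; right; rewrite asboolT//= => k _; rewrite /= x0.
move=> [[k _ [/= xk]]|]; first by rewrite (gauge_leading xk).
case: asboolP => // B0 x0; suff -> : x = fun=> 0 by rewrite gauge0.
apply/funext => n; have := x0 (pickle n) I.
by rewrite /= /intenum pickleK.
Qed.

Lemma abs_gauge_gt (r : R) x : 0 <= r -> r < `|gauge x| ->
  exists k, r < w k * `|x (intenum k)|.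
Proof.
move=> r0; have [[_ ->]|[k _ ->]] := gaugeP x; first by rewrite normr0 ltNge r0.
by rewrite normrM gtr0_norm//; exists k.
Qed.

End homogeneous_gauge.

Section stable_gauge.
Context {R : realType} (Q : {measure set (bisequence R) -> \bar R}) (alpha : R).
Hypothesis alpha_gt0 : 0 < alpha.
Hypothesis shiftQ : forall B : set (bisequence R), measurable B ->
  Q ((@shiftZ R) @^-1` B) = Q B.
Hypothesis intQ : (\int[Q]_x (Num.min ((x : int -> R) 0 ^+ 2) 1)%:E < +oo)%E.
Hypothesis Q0 : Q [set (fun=> 0)] = 0%E.
Hypothesis QT : Q setT != 0%E.
Hypothesis scaleQ : forall (t : R) (B : set (bisequence R)), 0 < t -> measurable B ->
  Q (dilateZ t @^-1` B) = ((t `^ alpha)%:E * Q B)%E.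

Lemma shift_coord n (B : set R) : measurable B ->
  Q [set x : bisequence R | B (x n)] = Q [set x : bisequence R | B (x 0)].
Proof.
move=> mB; have step m : Q [set x : bisequence R | B (x (m + 1))] = Q [set x : bisequence R | B (x m)].
  rewrite -[RHS]shiftQ// -[X in measurable X]setTI.
  exact: (measurable_coord m measurableT mB).
case: n => k; elim: k => [//|k IH]; first by rewrite -addn1 PoszD step.
  by rewrite -step.
rewrite -IH -(step (Negz k.+1)).
by have -> : Negz k.+1 + 1 = Negz k by rewrite !NegzE -[k.+2]addn1 PoszD opprD subrK.
Qed.

Lemma coord_tail_lty n : (Q [set x : bisequence R | (1 < `|x n|)%R] < +oo)%E.
Proof.
have mE : measurable [set x : bisequence R | 1 < `|x n|].
  rewrite (_ : mkset _ = (fun x : bisequence R => `|x n|) @^-1` `]1, +oo[%classic).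
    rewrite -[X in measurable X]setTI; apply: (measurableT_comp (@normr_measurable R setT) (measurable_coord n)) => //.
  by apply/seteqP; split=> x; rewrite /= in_itv/= andbT.
have := integrable_sqr_min1 shiftQ intQ n => /integrableP[_]; apply: le_lt_trans.
rewrite -[X in Q X]setIT -integral_indic//; apply: ge0_le_integral => //.
- exact/measurable_EFinP.
- apply: measurableT_comp => //; apply/measurable_EFinP.
  by case/integrableP: (integrable_sqr_min1 shiftQ intQ n) => /measurable_EFinP.
- move=> x _; rewrite /= lee_fin ger0_norm /sqr_min1; last by rewrite le_min sqr_ge0/=.
  rewrite indicE; have [x1|x1] := boolP (1 < `|x n|); last first.
    by rewrite memNset; [rewrite le_min sqr_ge0/=|exact/negP].
  rewrite mem_set// min_r// -real_normK ?num_real//.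
  by rewrite exprn_ege1// ltW.
Qed.

(** [B r] stands for the superlevel set at [r] of a homogeneous function, possibly cut by a
    dilation-invariant condition; the scaling of Q is applied with t = 1/r. *)
Lemma homogeneous_scaling (B : R -> set (bisequence R)) (r : R) : 0 < r ->
  measurable (B 1) -> (forall x, B r x <-> B 1 (dilateZ r^-1 x)) ->
  Q (B r) = ((r `^ (- alpha))%:E * Q (B 1%R))%E.
Proof.
move=> r0 mB Br; rewrite powRN -powR_inv1 ?powR_ge0// powRAC powR_inv1 ?(ltW r0)//.
rewrite -scaleQ ?invr_gt0//; congr (Q _); apply/seteqP.
by split=> x; rewrite /= Br.
Qed.

Let lt1_mull (a y : R) : 0 < a -> (1 < a * y) = (a^-1 < y).
Proof. by move=> a0; rewrite -[a^-1]mulr1 ltr_pdivrMl. Qed.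

(** Its power alpha is 2^-(k+1). By scaling, {weight k |x_k| > 1} then has mass C / 2^(k+1), where C
    is the mass of {|x_0| > 1}, and the union bound for the tail of the gauge sums to C. *)
Let weight (k : nat) : R := (2 ^- k.+1) `^ alpha^-1.

Let weight_gt0 k : 0 < weight k.
Proof. by rewrite powR_gt0// invr_gt0 exprn_gt0. Qed.

Local Notation N := (gauge weight).

Let measurable_abs_gt (h : bisequence R -> R) (r : R) : measurable_fun setT h ->
  measurable [set x | r < `|h x|].
Proof.
move=> mh; rewrite (_ : mkset _ = (fun x => `|h x|) @^-1` `]r, +oo[%classic).
  by rewrite -[X in measurable X]setTI; apply: (measurableT_comp (@normr_measurable R setT) mh).
by apply/seteqP; split=> x; rewrite /= in_itv/= andbT.
Qed.

Let tail_gauge_lty : (Q [set x | (1 < `|N x|)%R] < +oo)%E.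
Proof.
pose E k := [set x : bisequence R | 1 < weight k * `|x (intenum k)|].
have EE k : E k = [set x : bisequence R | (weight k)^-1 < `|x (intenum k)|].
  by apply/seteqP; split=> x; rewrite /E/= lt1_mull.
pose C := fine (Q [set x : bisequence R | 1 < `|x 0|]).
have QE k : Q (E k) = (C / 2 ^+ k.+1)%:E.
  rewrite EE (@homogeneous_scaling (fun r => [set x : bisequence R | r < `|x (intenum k)|])).
  - have -> : Q [set x : bisequence R | 1 < `|x (intenum k)|] = C%:E.
      have mB : measurable [set s : R | 1 < `|s|].
        rewrite (_ : mkset _ = (fun s : R => `|s|) @^-1` `]1, +oo[%classic).
          by rewrite -[X in measurable X]setTI; exact: (@normr_measurable R setT).
        by apply/seteqP; split=> s; rewrite /= in_itv/= andbT.
      rewrite (shift_coord (intenum k) mB) fineK//.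
      by rewrite ge0_fin_numE ?measure_ge0//; exact: coord_tail_lty.
    rewrite -EFinM mulrC; congr (_ * _)%:E.
    rewrite powRN -(powR_inv1 (ltW (weight_gt0 k))) -powRrM mulN1r powRN invrK.
    by rewrite /weight -powRrM mulVf ?gt_eqF// powRr1// invr_ge0 exprn_ge0.
  - by rewrite invr_gt0.
  - by apply: measurable_abs_gt; exact: measurable_coord.
  - by move=> x; rewrite /= /dilateZ invrK normrM gtr0_norm// lt1_mull.
have mE k : measurable (E k) by rewrite EE; apply: measurable_abs_gt; exact: measurable_coord.
apply: (@le_lt_trans _ _ (\sum_(k <oo) Q (E k))%E).
  apply: measure_sigma_subadditive => //.
    by apply: measurable_abs_gt; exact: measurable_gauge.
  by move=> x /(abs_gauge_gt weight_gt0 ler01)[k xk]; exists k.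
rewrite (_ : (\sum_(k <oo) _)%E = C%:E) ?ltry//.
apply/cvg_lim => //.
have := @cvg_geometric_eseries_half R C 0.
rewrite expr0 divr1; apply: cvg_trans; apply: near_eq_cvg; apply: nearW => n.
by rewrite /eseries/=; apply: eq_bigr => k _; rewrite QE addn1 natrX.
Qed.

(** If this tail were null, scaling would make every tail {|N| > 1/(k+1)} null; together with the
    null zero sequence these cover the space, against Q being nonzero. *)
Let tail_gauge_gt0 : (0 < Q [set x | (1 < `|N x|)%R])%E.
Proof.
rewrite lt_neqAle measure_ge0 andbT eq_sym; apply/negP => /eqP N0.
have m0 : measurable [set (fun=> 0) : bisequence R].
  rewrite (_ : [set _] = N @^-1` [set 0]).
    by rewrite -[X in measurable X]setTI; exact: measurable_gauge.
  apply/seteqP; split=> x /=; first by move=> ->; rewrite gauge0.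
  exact: gauge_eq0.
have QN k : Q [set x | k.+1%:R^-1 < `|N x|] = 0%E.
  rewrite (@homogeneous_scaling (fun r => [set x | r < `|N x|])).
  - by rewrite N0 mule0.
  - by [].
  - by apply: measurable_abs_gt; exact: measurable_gauge.
  - by move=> x; rewrite /= gauge_dilateZ// invrK normrM normr_nat lt1_mull.
have /negP := QT; apply; rewrite -measure_le0.
have mN k : measurable [set x | k.+1%:R^-1 < `|N x|].
  by apply: measurable_abs_gt; exact: measurable_gauge.
have mU : measurable (\bigcup_k [set x | k.+1%:R^-1 < `|N x|]) by exact: bigcup_measurable.
have -> : setT = [set (fun=> 0)] `|` \bigcup_k [set x | k.+1%:R^-1 < `|N x|].
  apply/esym; rewrite -subTset => x _.
  have [x0|x0] := eqVneq (N x) 0; first by left; exact: gauge_eq0 x0.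
  right; exists (Num.bound `|N x|^-1) => //=.
  rewrite invf_plt ?posrE ?normr_gt0//.
  by rewrite (lt_le_trans (archi_boundP _))// ?invr_ge0// ler_nat.
rewrite (le_trans (measureU2 _ m0 mU))// [X in (X + _)%E]Q0 add0e.
rewrite (le_trans (measure_sigma_subadditive _ mN mU _))//.
by rewrite eseries0// => k _ _; exact: QN.
Qed.

Lemma exists_stable_gauge : exists N : bisequence R -> R,
  [/\ measurable_fun setT N, (forall t x, N (dilateZ t x) = t * N x),
      (forall x, N x = 0 -> x = fun=> 0) &
      Q [set x | 1 < `|N x|] = (2 / alpha)%:E].
Proof.
pose q := fine (Q [set x | 1 < `|N x|]).
have q0 : 0 < q by rewrite fine_gt0// tail_gauge_gt0.
have qE : Q [set x | 1 < `|N x|] = q%:E.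
  by rewrite fineK// ge0_fin_numE// measure_ge0.
(* Multiplying the gauge by [b] multiplies the mass of its tail by b^alpha. *)
pose b := (2 / alpha / q) `^ alpha^-1.
have b0 : 0 < b by rewrite powR_gt0// !divr_gt0.
exists (fun x => b * N x); split.
- by apply: measurable_funM => //; exact: measurable_gauge.
- by move=> t x; rewrite gauge_dilateZ// mulrCA.
- move=> x /eqP; rewrite mulf_eq0 (gt_eqF b0)/= => /eqP.
  exact: gauge_eq0.
rewrite (_ : mkset _ = [set x | b^-1 < `|N x|]); last first.
  by apply/seteqP; split=> x; rewrite /= normrM gtr0_norm// lt1_mull.
rewrite (@homogeneous_scaling (fun r => [set x | r < `|N x|])).
- rewrite qE -EFinM; congr EFin.
  rewrite powRN -(powR_inv1 (ltW b0)) -powRrM mulN1r powRN invrK /b -powRrM mulVf ?gt_eqF//.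
  by rewrite powRr1 ?divfK ?gt_eqF// !divr_ge0// ltW.
- by rewrite invr_gt0.
- by apply: measurable_abs_gt; exact: measurable_gauge.
- by move=> x; rewrite /= gauge_dilateZ// invrK normrM gtr0_norm// lt1_mull.
Qed.

End stable_gauge.

Definition measure_pushforward d d' (T : measurableType d) (T' : measurableType d')
    (R : realType) (m : {measure set T -> \bar R}) (f : T -> T')
    (mf : measurable_fun setT f) : {measure set T' -> \bar R}.
Proof. by refine (pushforward m f). Defined.

Lemma mnormalizeE d (T : measurableType d) (R : realType)
    (m : {measure set T -> \bar R}) (P : probability T R) (A : set T) (c : R) :
  0 < c -> m setT = c%:E -> mnormalize m P A = (m A * c^-1%:E)%E.
Proof. by move=> c0 mc; rewrite /mnormalize mc gt_eqF ?lte_fin. Qed.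

Lemma measurable_invr (R : realType) : measurable_fun setT (@GRing.inv R).
Proof.
(* The outer factor [y] makes both sides 0 at 0. *)
rewrite (_ : @GRing.inv R = fun y => y * (`|y| `^ (-1)) ^+ 2).
  apply: measurable_funM => //; apply: measurable_funX.
  exact: (measurableT_comp (measurable_powR _)).
apply/funext => y; have [->|y0] := eqVneq y 0; first by rewrite invr0 mul0r.
rewrite powR_inv1// exprVn real_normK ?num_real// expr2 invfM mulrA divff// mul1r.
by [].
Qed.

(** * Product structure of the Levy measure in polar coordinates *)

Section polar_decomposition.
Context {R : realType} (Q : {measure set (bisequence R) -> \bar R}) (alpha : R).
Hypothesis alpha_gt0 : 0 < alpha.
Hypothesis Q0 : Q [set (fun=> 0)] = 0%E.
Hypothesis negQ : forall B : set (bisequence R), measurable B ->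
  Q (dilateZ (-1) @^-1` B) = Q B.
Hypothesis scaleQ : forall (t : R) (B : set (bisequence R)), 0 < t -> measurable B ->
  Q (dilateZ t @^-1` B) = ((t `^ alpha)%:E * Q B)%E.
Variable N : bisequence R -> R.
Hypothesis mN : measurable_fun setT N.
Hypothesis NZ : forall t x, N (dilateZ t x) = t * N x.
Hypothesis N0 : forall x, N x = 0 -> x = fun=> 0.
Hypothesis NQ : Q [set x | 1 < `|N x|] = (2 / alpha)%:E.

Definition direction (x : bisequence R) : bisequence R := dilateZ (N x)^-1 x.

Lemma measurable_direction : measurable_fun setT direction.
Proof.
apply: measurable_bisequence => n; apply: measurable_funM; last exact: measurable_coord.
exact: measurableT_comp (@measurable_invr R) mN.
Qed.

Lemma dilateZZ (s t : R) x : dilateZ s (dilateZ t x) = dilateZ (s * t) x.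
Proof. by apply/funext => n; rewrite /dilateZ mulrA. Qed.

Lemma dilateZ1 (x : bisequence R) : dilateZ 1 x = x.
Proof. by apply/funext => n; rewrite /dilateZ mul1r. Qed.

Lemma direction_dilateZ t x : t != 0 -> direction (dilateZ t x) = direction x.
Proof.
move=> t0; rewrite /direction NZ dilateZZ invfM mulrAC mulVf// mul1r.
by [].
Qed.

Lemma directionK x : dilateZ (N x) (direction x) = x.
Proof.
have [Nx0|Nx0] := eqVneq (N x) 0; last by rewrite /direction dilateZZ divff// dilateZ1.
by rewrite Nx0 [in RHS](N0 Nx0); apply/funext => n; rewrite /dilateZ mul0r.
Qed.

Lemma gauge_direction x : N x != 0 -> N (direction x) = 1.
Proof. by move=> Nx0; rewrite /direction NZ mulVf. Qed.

Lemma direction_id x : N x = 1 -> direction x = x.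
Proof. by move=> Nx; rewrite /direction Nx invr1 dilateZ1. Qed.

Let measurable_tail : measurable [set x | 1 < `|N x|].
Proof.
rewrite (_ : mkset _ = (fun x => `|N x|) @^-1` `]1, +oo[%classic).
  by rewrite -[X in measurable X]setTI; apply: (measurableT_comp (@normr_measurable R setT) mN).
by apply/seteqP; split=> x; rewrite /= in_itv/= andbT.
Qed.

(** The law of the direction under Q conditioned on |N| > 1. The Dirac mass is the fallback of
    [mnormalize] for a degenerate total mass, a case excluded by [NQ]. *)
Definition polar_measure : probability (bisequence R) R :=
  distribution (mnormalize (mrestr Q measurable_tail) \d_((fun=> 0) : bisequence R))
    (mfun_Sub (mem_set measurable_direction)).

Lemma polar_measureE A :
  polar_measure A = ((alpha / 2)%:E * Q (direction @^-1` A `&` [set x | (1 < `|N x|)%R]))%E.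
Proof.
have a2 : 0 < 2 / alpha by rewrite divr_gt0.
have massE : mrestr Q measurable_tail setT = (2 / alpha)%:E by rewrite /mrestr setTI.
have := mnormalizeE \d_((fun=> 0) : bisequence R) (direction @^-1` A) a2 massE.
by rewrite muleC invf_div.
Qed.

Let measurable_preimage_direction A : measurable A -> measurable (direction @^-1` A).
Proof. by move=> mA; rewrite -[X in measurable X]setTI; exact: measurable_direction. Qed.

Let measurable_preimage_N B : measurable B -> measurable (N @^-1` B).
Proof. by move=> mB; rewrite -[X in measurable X]setTI; exact: mN. Qed.

Let Q_direction_gt A r : measurable A -> 0 < r ->
  Q (direction @^-1` A `&` [set x | r < N x]) =
  ((r `^ (- alpha))%:E * Q (direction @^-1` A `&` [set x | (1 < N x)%R]))%E.
Proof.
move=> mA r0; rewrite (@homogeneous_scaling _ _ _ scaleQ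
    (fun r => direction @^-1` A `&` [set x | r < N x]))//.
  apply: measurableI; first exact: measurable_preimage_direction.
  rewrite (_ : mkset _ = N @^-1` `]1, +oo[%classic); first exact: measurable_preimage_N.
  by apply/seteqP; split=> x; rewrite /= in_itv/= andbT.
move=> x; rewrite /= direction_dilateZ ?invr_eq0 ?gt_eqF// NZ.
by rewrite ltr_pdivlMl ?mulr1.
Qed.

(** Directions are also invariant under negative dilations, so the reflection exchanges the two
    signs of the radius and keeps [A]. The symmetry of Q enters the product structure here. *)
Let Q_direction_lt A r : measurable A ->
  Q (direction @^-1` A `&` [set x | N x < - r]) = Q (direction @^-1` A `&` [set x | r < N x]).
Proof.
move=> mA; rewrite -[RHS]negQ.
  congr (Q _); apply/seteqP; split=> x /=; rewrite direction_dilateZ ?oppr_eq0// NZ mulN1r.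
    by rewrite ltrNr.
  by rewrite ltrNr.
apply: measurableI; first exact: measurable_preimage_direction.
rewrite (_ : mkset _ = N @^-1` `]r, +oo[%classic); first exact: measurable_preimage_N.
by apply/seteqP; split=> x; rewrite /= in_itv/= andbT.
Qed.

Let Q_direction_gt1 A : measurable A ->
  Q (direction @^-1` A `&` [set x | 1 < N x]) = (alpha^-1%:E * polar_measure A)%E.
Proof.
move=> mA; rewrite polar_measureE.
have mI B : measurable B -> measurable (direction @^-1` A `&` N @^-1` B).
  by move=> mB; apply: measurableI; [exact: measurable_preimage_direction|exact: measurable_preimage_N].
have gtE : [set x | 1 < N x] = N @^-1` `]1, +oo[%classic.
  by apply/seteqP; split=> x; rewrite /= in_itv/= andbT.
have ltE : [set x | N x < - 1] = N @^-1` `]-oo, (-1)%R[%classic.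
  by apply/seteqP; split=> x; rewrite /= in_itv/=.
have -> : direction @^-1` A `&` [set x | 1 < `|N x|] =
    (direction @^-1` A `&` [set x | 1 < N x]) `|` (direction @^-1` A `&` [set x | N x < - 1]).
  rewrite -setIUr; congr (_ `&` _); apply/seteqP; split=> x /=.
    by rewrite ltr_normr ltrNr => /orP.
  by rewrite ltr_normr ltrNr => h; exact/orP.
rewrite measureU; [|by rewrite gtE; exact: mI|by rewrite ltE; exact: mI|].
  rewrite [X in (_ + X)%E]Q_direction_lt//.
  set q := Q _; have q_fin : q \is a fin_num.
    rewrite ge0_fin_numE ?measure_ge0//.
    apply: (@le_lt_trans _ _ (Q [set x | 1 < `|N x|])); last by rewrite NQ ltry.
    apply: le_measure; rewrite ?inE//; first by rewrite gtE; exact: mI.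
    by move=> x [_ /=]; move=> /lt_le_trans; apply; exact: ler_norm.
  rewrite [X in (X + _)%E](_ : _ = q)// -(fineK q_fin) -EFinD -!EFinM; congr EFin.
  by field; rewrite gt_eqF.
rewrite -subset0 => x [[_ /= x1] [_ /= x2]]; have := lt_trans x1 x2; lra.
Qed.

Definition polar (x : bisequence R) : bisequence R * R := (direction x, N x).

Lemma measurable_polar : measurable_fun setT polar.
Proof. by apply: measurable_fun_pair => //; exact: measurable_direction. Qed.

(** For fixed [A] both sides are measures in [B]. They agree on the signed rays, by scaling for the
    positive ones and by reflection for the negative ones, and both vanish on {0}; this pi-system
    determines them. *)
Let polar_rectangle A B : measurable A -> measurable B ->
  Q (polar @^-1` (A `*` B)) = (polar_measure A * radial_measure alpha B)%E.
Proof.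
move=> mA mB.
have mdA := measurable_preimage_direction mA.
pose m1 := measure_pushforward (mrestr Q mdA) mN.
have nuA_fin : polar_measure A \is a fin_num by exact: fin_num_measure.
have nuA_ge0 : 0 <= fine (polar_measure A) by rewrite fine_ge0.
pose m2 := mscale (NngNum nuA_ge0) (radial_measure alpha).
have m1E C : m1 C = Q (direction @^-1` A `&` N @^-1` C).
  by rewrite /m1 /= /pushforward /mrestr setIC.
have m2E C : m2 C = (polar_measure A * radial_measure alpha C)%E.
  by rewrite /m2 /= /mscale /= fineK.
have zeroE : N @^-1` [set 0] = [set (fun=> 0)].
  apply/seteqP; split=> x /=; first exact: N0.
  move=> ->; have := NZ 0 (fun=> 0); rewrite mul0r.
  by rewrite (_ : dilateZ 0 _ = fun=> 0)//; apply/funext => n; rewrite /dilateZ mul0r.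
have m1_0 : m1 [set 0] = 0%E.
  rewrite m1E zeroE; apply: (subset_measure0 _ _ _ Q0).
  - by rewrite -zeroE; apply: measurableI => //; exact: measurable_preimage_N.
  - by rewrite -zeroE; exact: measurable_preimage_N.
  - exact: subIsetr.
have m1_gt r : 0 < r -> m1 `]r, +oo[%classic = ((r `^ (- alpha) / alpha)%:E * polar_measure A)%E.
  move=> r0; rewrite m1E.
  rewrite (_ : N @^-1` _ = [set x | r < N x]); last first.
    by apply/seteqP; split=> x; rewrite /= in_itv/= andbT.
  by rewrite Q_direction_gt// Q_direction_gt1// muleA -EFinM.
have m1_lt r : 0 < r -> m1 `]-oo, (- r)%R[%classic = ((r `^ (- alpha) / alpha)%:E * polar_measure A)%E.
  move=> r0; rewrite -m1_gt// !m1E.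
  rewrite (_ : N @^-1` `]-oo, (- r)%R[%classic = [set x | N x < - r]); last first.
    by apply/seteqP; split=> x; rewrite /= in_itv/=.
  rewrite (_ : N @^-1` `]r, +oo[%classic = [set x | r < N x]); last first.
    by apply/seteqP; split=> x; rewrite /= in_itv/= andbT.
  exact: Q_direction_lt.
have := m2E B => <-; have := m1E B; rewrite /polar => m1B.
transitivity (m1 B); first by rewrite m1B.
(* A cover of R by sets of finite mass: {0}, then left rays for even [j] and right rays for odd [j],
   with endpoints tending to 0. *)
pose g k : set R := if k is j.+1 then
  (if odd j then `]j.+1%:R^-1, +oo[%classic else `]-oo, (- j.+1%:R^-1)%R[%classic) else [set 0].
apply: (measure_unique (@signed_rays R) g) => //.
- exact: measurable_signed_rays.
- exact: signed_rays_setI.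
- case=> [|j]; rewrite /g; first exact: Or42.
  by case: ifP => _; [apply: Or43|apply: Or44]; exists j.+1%:R^-1.
- rewrite -subTset => s _.
  have inv_lt (e : R) : 0 < e -> exists k, forall j, (k <= j)%N -> j.+1%:R^-1 < e.
    move=> e0; exists (Num.bound e^-1) => j kj.
    rewrite invf_plt ?posrE// (lt_le_trans (archi_boundP _))// ?invr_ge0 ?(ltW e0)//.
    by rewrite ler_nat leqW.
  have [s0|s0|->] := ltgtP s 0; last by exists 0%N.
    have [k ks] : exists k, forall j, (k <= j)%N -> j.+1%:R^-1 < - s by apply: inv_lt; rewrite oppr_gt0.
    exists k.*2.+1 => //; rewrite /g odd_double/= in_itv/= ltrNr ks//.
    by rewrite -addnn leq_addr.
  have [k ks] := inv_lt _ s0.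
  exists k.*2.+2 => //; rewrite /g /= odd_double/= in_itv/= andbT ks//.
  by rewrite -addnn -addnS leq_addr.
- move=> C [->|->|[r r0 ->]|[r r0 ->]].
  + by rewrite !measure0.
  + apply: (etrans m1_0); apply/esym; apply: (etrans (m2E _)).
    by rewrite radial_measure_set1 mule0.
  + apply: (etrans (m1_gt _ r0)); apply/esym; apply: (etrans (m2E _)).
    by rewrite radial_measure_gt// muleC.
  + apply: (etrans (m1_lt _ r0)); apply/esym; apply: (etrans (m2E _)).
    by rewrite radial_measure_lt// muleC.
- have fin_lty (c : R) : (c%:E * polar_measure A < +oo)%E.
    by rewrite -(fineK nuA_fin) -EFinM ltry.
  have eq_lty (x y : \bar R) : x = y -> (y < +oo -> x < +oo)%E by move=> ->.
  case=> [|j]; first exact: eq_lty m1_0 (ltry _).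
  have j0 : 0 < j.+1%:R^-1 :> R by [].
  by rewrite /g; case: ifP => _;
    [apply: eq_lty (m1_gt _ j0) _|apply: eq_lty (m1_lt _ j0) _].
Qed.

Lemma polar_product X : measurable X ->
  (polar_measure \x radial_measure alpha)%E X = Q (polar @^-1` X).
Proof.
apply: (product_measure_unique (m' := measure_pushforward Q measurable_polar)).
exact: polar_rectangle.
Qed.

Lemma polar_measure_gauge1 : polar_measure [set x | N x != 1] = 0%E.
Proof.
rewrite polar_measureE (_ : _ `&` _ = set0) ?measure0 ?mule0//.
rewrite -subset0 => x [/= + x1]; rewrite gauge_direction ?eqxx//.
by rewrite -normr_gt0 (lt_trans _ x1).
Qed.

End polar_decomposition.

(** * The action of the shift on directions *)

Section skew_base.
Context {R : realType} (Q : {measure set (bisequence R) -> \bar R}) (alpha : R).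
Hypothesis alpha_gt0 : 0 < alpha.
Hypothesis shiftQ : forall B : set (bisequence R), measurable B ->
  Q ((@shiftZ R) @^-1` B) = Q B.
Hypothesis Q0 : Q [set (fun=> 0)] = 0%E.
Hypothesis negQ : forall B : set (bisequence R), measurable B ->
  Q (dilateZ (-1) @^-1` B) = Q B.
Hypothesis scaleQ : forall (t : R) (B : set (bisequence R)), 0 < t -> measurable B ->
  Q (dilateZ t @^-1` B) = ((t `^ alpha)%:E * Q B)%E.
Variable N : bisequence R -> R.
Hypothesis mN : measurable_fun setT N.
Hypothesis NZ : forall t x, N (dilateZ t x) = t * N x.
Hypothesis N0 : forall x, N x = 0 -> x = fun=> 0.
Hypothesis NQ : Q [set x | 1 < `|N x|] = (2 / alpha)%:E.

Local Notation nu := (polar_measure Q mN).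
Local Notation dir := (direction N).

Definition unshiftZ (x : bisequence R) : bisequence R := fun n => x (n - 1).

Lemma measurable_unshiftZ : measurable_fun setT unshiftZ.
Proof. by apply: measurable_bisequence => n; exact: measurable_coord. Qed.

Lemma shiftZK : cancel (@shiftZ R) unshiftZ.
Proof. by move=> x; apply/funext => n; rewrite /unshiftZ /shiftZ subrK. Qed.

Lemma unshiftZK : cancel unshiftZ (@shiftZ R).
Proof. by move=> x; apply/funext => n; rewrite /unshiftZ /shiftZ addrK. Qed.

Lemma shiftZ_dilateZ (t : R) (x : bisequence R) : shiftZ (dilateZ t x) = dilateZ t (shiftZ x).
Proof. by []. Qed.

Lemma unshiftZ_dilateZ (t : R) (x : bisequence R) : unshiftZ (dilateZ t x) = dilateZ t (unshiftZ x).
Proof. by []. Qed.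

Let zero_gauge : N (fun=> 0) = 0.
Proof.
have := NZ 0 (fun=> 0); rewrite mul0r (_ : dilateZ 0 _ = fun=> 0)//.
by apply/funext => n; rewrite /dilateZ mul0r.
Qed.

Lemma gauge_shift_neq0 x : N x != 0 -> N (shiftZ x) != 0.
Proof.
apply: contra => /eqP/N0 sx; rewrite -(shiftZK x) sx.
by rewrite (_ : unshiftZ _ = fun=> 0) ?zero_gauge.
Qed.

Lemma gauge_unshift_neq0 x : N x != 0 -> N (unshiftZ x) != 0.
Proof.
apply: contra => /eqP/N0 sx; rewrite -(unshiftZK x) sx.
by rewrite (_ : @shiftZ R _ = fun=> 0) ?zero_gauge.
Qed.

(* The shift acts on the cross-section {N = 1} of the dilations; off this
   nu-conull set the map is the identity, so that it is a bijection everywhere. *)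
Definition base_map (T : bisequence R -> bisequence R) (x : bisequence R) :=
  if N x == 1 then dir (T x) else x.

Let measurable_base_map T : measurable_fun setT T -> measurable_fun setT (base_map T).
Proof.
move=> mT; apply: measurable_fun_ifT => //.
- exact: measurable_fun_eqr.
- by apply: measurableT_comp mT; exact: measurable_direction.
Qed.

Let base_mapK (T T' : bisequence R -> bisequence R) :
  (forall x, T' (T x) = x) -> (forall x, N x != 0 -> N (T x) != 0) ->
  (forall t x, T' (dilateZ t x) = dilateZ t (T' x)) ->
  cancel (base_map T) (base_map T').
Proof.
move=> TK TN TZ x; rewrite /base_map.
have [Nx|Nx] := eqVneq (N x) 1; last by rewrite (negbTE Nx).
have NTx : N (T x) != 0 by apply: TN; rewrite Nx oner_neq0.
rewrite gauge_direction// eqxx TZ TK direction_dilateZ ?invr_eq0//.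
exact: direction_id.
Qed.

Definition base_shift : {mfun bisequence R >-> bisequence R} :=
  mfun_Sub (mem_set (measurable_base_map (@measurable_shiftZ R))).

Definition base_unshift : {mfun bisequence R >-> bisequence R} :=
  mfun_Sub (mem_set (measurable_base_map measurable_unshiftZ)).

Lemma base_unshiftE x : base_unshift x = base_map unshiftZ x.
Proof. by []. Qed.

Lemma base_shiftK : cancel base_shift base_unshift.
Proof.
exact: (base_mapK shiftZK gauge_shift_neq0 unshiftZ_dilateZ).
Qed.

Lemma base_unshiftK : cancel base_unshift base_shift.
Proof.
exact: (base_mapK unshiftZK gauge_unshift_neq0 shiftZ_dilateZ).
Qed.

(** By Fubini: over a direction [x] in [A] the section is {|s| > 1 / |h x|}, of radial mass 2 /
    alpha |h x|^alpha. The case of the shift factor yields the derivative, that of coordinate 0 the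
    integrability of [f]. *)
Lemma polar_tail_integral (A : set (bisequence R)) (h : bisequence R -> R) :
  measurable A -> measurable_fun setT h ->
  Q [set y | A (dir y) /\ 1 < `|N y * h (dir y)| ] =
  (\int[nu]_(x in A) (2 / alpha * `|h x| `^ alpha)%:E)%E.
Proof.
move=> mA mh.
pose X : set (bisequence R * R) := [set p | A p.1 /\ 1 < `|p.2 * h p.1|].
have mX : measurable X.
  rewrite (_ : X = (A `*` setT) `&` (fun p : bisequence R * R => `|p.2 * h p.1|) @^-1` `]1, +oo[%classic).
    apply: measurableI; first exact: measurableX.
    have mf : measurable_fun setT (fun p : bisequence R * R => `|p.2 * h p.1|).
      apply: measurableT_comp => //; apply: measurable_funM => //.
      by apply: measurableT_comp => //.
    by rewrite -[X in measurable X]setTI; exact: mf.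
  by apply/seteqP; split=> p; rewrite /X/= in_itv/= andbT => -[]//; case.
rewrite (_ : mkset _ = polar N @^-1` X)// -(polar_product alpha_gt0 Q0 negQ scaleQ mN NZ N0 NQ)//.
rewrite /product_measure1 integral_mkcond/= [RHS]integral_mkcond.
apply: eq_integral => x _; rewrite !patchE in_setT /=.
case: ifPn => [/set_mem xA|/negP xA].
  have [hx|hx] := eqVneq (h x) 0.
    rewrite hx normr0 powR0 ?gt_eqF// mulr0 (_ : xsection X x = set0) ?measure0//.
    rewrite -subset0 => t; rewrite /xsection/= inE => -[_ /=].
    by rewrite hx mulr0 normr0 ltr10.
  have hx0 : 0 < `|h x| by rewrite normr_gt0.
  rewrite (_ : xsection X x = [set s | `|h x|^-1 < `|s|]).
    rewrite radial_measure_norm_gt ?invr_gt0//; congr (2 / _ * _)%:E.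
    by rewrite powRN -(powR_inv1 (ltW hx0)) -powRrM mulN1r powRN invrK.
  apply/seteqP; split=> t; rewrite /xsection /= inE /X /= normrM.
    by move=> [_]; rewrite -ltr_pdivrMr// div1r.
  by move=> xt; split=> //; rewrite -ltr_pdivrMr// div1r.
rewrite (_ : xsection X x = set0) ?measure0//.
rewrite -subset0 => t; rewrite /xsection/= inE => -[Ax _].
by exfalso; apply: xA; rewrite inE.
Qed.

Definition shift_factor (x : bisequence R) : R := N (shiftZ x).

Lemma measurable_shift_factor : measurable_fun setT shift_factor.
Proof. by apply: measurableT_comp mN _; exact: measurable_shiftZ. Qed.

Let measurable_tail (h : bisequence R -> R) (A : set (bisequence R)) :
  measurable_fun setT h -> measurable A ->
  measurable (dir @^-1` A `&` [set x | 1 < `|h x|]).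
Proof.
move=> mh mA; apply: measurableI.
  by rewrite -[X in measurable X]setTI; exact: measurable_direction.
rewrite (_ : mkset _ = (fun x => `|h x|) @^-1` `]1, +oo[%classic).
  by rewrite -[X in measurable X]setTI; apply: (measurableT_comp (@normr_measurable R setT) mh).
by apply/seteqP; split=> x; rewrite /= in_itv/= andbT.
Qed.

(* By shift invariance, the event that |N y| > 1 and the direction of
   unshift y lies in A has the mass of the event that |N (shift z)| > 1 and
   the direction of z lies in A. *)
Lemma distribution_base_unshift A : measurable A ->
  distribution nu base_unshift A = (\int[nu]_(x in A) (`|shift_factor x| `^ alpha)%:E)%E.
Proof.
move=> mA; rewrite /distribution /pushforward (polar_measureE alpha_gt0 mN NQ).
rewrite (_ : _ `&` _ = (fun x => dir (unshiftZ x)) @^-1` A `&` [set x | 1 < `|N x|]); last first.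
  rewrite (_ : dir @^-1` (base_unshift @^-1` A) `&` [set x | 1 < `|N x|] =
    [set x | A (base_unshift (dir x)) /\ 1 < `|N x|])//.
  suff e x : 1 < `|N x| -> base_unshift (dir x) = dir (unshiftZ x).
    apply/seteqP; split=> x [Ax x1]; split=> //; first exact: (@eq_ind _ _ A Ax _ (e x x1)).
    exact: (@eq_ind _ _ A Ax _ (esym (e x x1))).
  move=> x1; have Nx : N x != 0 by rewrite -normr_gt0 (lt_trans _ x1).
  rewrite base_unshiftE /base_map gauge_direction// eqxx /direction unshiftZ_dilateZ.
  by rewrite -!/(direction N _) direction_dilateZ ?invr_eq0.
have mU : measurable ((fun x => dir (unshiftZ x)) @^-1` A `&` [set x | 1 < `|N x|]).
  apply: measurableI.
    rewrite -[X in measurable X]setTI; apply: (measurableT_comp (measurable_direction mN) measurable_unshiftZ) => //.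
  by have := measurable_tail mN measurableT; rewrite preimage_setT setTI.
rewrite -shiftQ//.
rewrite (_ : _ @^-1` _ = [set y | A (dir y) /\ 1 < `|N y * shift_factor (dir y)|]); last first.
  have e y : N y * shift_factor (dir y) = N (shiftZ y).
    by rewrite /shift_factor -NZ -shiftZ_dilateZ directionK.
  by apply/seteqP; split=> y /=; rewrite shiftZK e.
rewrite polar_tail_integral//; last exact: measurable_shift_factor.
rewrite (_ : (fun x => _) = (fun x => (2 / alpha)%:E * (`|shift_factor x| `^ alpha)%:E)%E); last first.
  by apply/funext => x; rewrite EFinM.
rewrite ge0_integralZl//.
- rewrite muleA -EFinM (_ : alpha / 2 * (2 / alpha) = 1) ?mul1e//.
  by field; rewrite gt_eqF.
- apply/measurable_EFinP; apply: measurable_funTS; apply: (measurableT_comp (measurable_powR _)).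
  by apply: measurableT_comp => //; exact: measurable_shift_factor.
- by rewrite lee_fin divr_ge0// ltW.
Qed.

Lemma gauge_ae1 : {ae nu, forall x, N x = 1}.
Proof.
have mE : measurable [set x | N x != 1].
  rewrite (_ : mkset _ = N @^-1` (~` [set 1])).
    by rewrite -[X in measurable X]setTI; apply: mN => //; exact: measurableC.
  by apply/seteqP; split=> x /= /eqP.
exists [set x | N x != 1]; split=> //; first by have := polar_measure_gauge1 alpha_gt0 mN NZ NQ.
by move=> x /= /eqP.
Qed.

Lemma shift_factor_neq0 x : N x = 1 -> shift_factor x != 0.
Proof. by move=> Nx; apply: gauge_shift_neq0; rewrite Nx oner_neq0. Qed.

Let measurable_density (A : set (bisequence R)) :
  measurable_fun A (fun x => (`|shift_factor x| `^ alpha)%:E).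
Proof.
apply/measurable_EFinP; apply: measurable_funTS; apply: (measurableT_comp (measurable_powR _)).
by apply: measurableT_comp => //; exact: measurable_shift_factor.
Qed.

(** The density |J|^alpha is almost everywhere nonzero, since only the zero sequence has a zero
    shift. *)
Lemma distribution_base_unshift_eq0 A : measurable A ->
  distribution nu base_unshift A = 0%E <-> nu A = 0%E.
Proof.
move=> mA; rewrite distribution_base_unshift//; split=> [|A0]; last first.
  by rewrite null_set_integral//; exact: measurable_density.
rewrite (_ : (fun x => _) = (fun x => `|(`|shift_factor x| `^ alpha)%:E|)%E); last first.
  by apply/funext => x; rewrite gee0_abs// lee_fin powR_ge0.
move=> /(ae_eq_integral_abs nu mA (@measurable_density A)) h.
have : {ae nu, forall x, ~ A x}.
  apply: filterS2 gauge_ae1 h => x Nx h Ax; have := h Ax => /= -[] /eqP.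
  by rewrite powR_eq0 normr_eq0 (negbTE (shift_factor_neq0 Nx)).
move=> [Z [mZ Z0 AZ]]; apply: (subset_measure0 mA mZ _ Z0).
by move=> x Ax; apply: AZ => /=; exact.
Qed.

(** Both dominations come from the equivalence of null sets for [base_unshift], applied to the
    preimage of [A] under [base_shift]. *)
Lemma nonsingular_base_shift : nonsingular_automorphism nu base_shift base_unshift.
Proof.
have mS A : measurable A -> measurable (base_shift @^-1` A).
  by move=> mA; rewrite -[X in measurable X]setTI; exact: (@measurable_funPT _ _ _ _ base_shift).
have SS A : base_unshift @^-1` (base_shift @^-1` A) = A.
  by apply/funext => x; exact: (congr1 A (base_unshiftK x)).
split; [exact: base_shiftK|exact: base_unshiftK| |].
  apply/null_content_dominatesP => A mA A0.
  apply/(distribution_base_unshift_eq0 (mS _ mA)).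
  by rewrite /distribution /pushforward SS.
apply/null_content_dominatesP => A mA A0.
have /(distribution_base_unshift_eq0 (mS _ mA)) : nu (base_shift @^-1` A) = 0%E by [].
by rewrite /distribution /pushforward SS.
Qed.

Lemma rn_density_ae : {ae nu, forall x, rn_density nu base_unshift x = `|shift_factor x| `^ alpha}.
Proof.
have dom : distribution nu base_unshift `<< nu.
  by apply/null_content_dominatesP => A mA A0; apply/distribution_base_unshift_eq0.
have dom' : charge_of_finite_measure (distribution nu base_unshift) `<< nu by [].
have h := integral_ae_eq measurableT (Radon_Nikodym_integrable dom') (@measurable_density setT).
have {}h : ae_eq nu setT (Radon_Nikodym (charge_of_finite_measure (distribution nu base_unshift)) nu)
    (fun x => (`|shift_factor x| `^ alpha)%:E).
  apply: h => E _ mE; rewrite -Radon_Nikodym_integral//.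
  exact: distribution_base_unshift.
(* On the cross-section the derivative is positive, so the default value 1 of [rn_density] is not
   taken. *)
apply: filterS2 gauge_ae1 h => x Nx /(_ I) h; rewrite /rn_density h /=.
by rewrite powR_gt0// normr_gt0 shift_factor_neq0.
Qed.

End skew_base.

Lemma measurable_eq_set d (T : measurableType d) (R : realType) (f g : T -> R) :
  measurable_fun setT f -> measurable_fun setT g -> measurable [set x | f x = g x].
Proof.
move=> mf mg; rewrite (_ : mkset _ = (f \- g) @^-1` [set 0]).
  by rewrite -[X in measurable X]setTI; exact: measurable_funB.
by apply/seteqP; split=> x /= => [->|/eqP]; rewrite ?subrr// subr_eq0 => /eqP.
Qed.

Lemma eq_measure_conull d (T : measurableType d) (R : realType)
    (m : {measure set T -> \bar R}) (A B C : set T) :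
  measurable A -> measurable B -> measurable C -> m (~` C) = 0%E ->
  (forall x, C x -> A x <-> B x) -> m A = m B.
Proof.
move=> mA mB mC C0 AB.
have mI D : measurable D -> m D = m (D `&` C).
  move=> mD; rewrite (measureDI m mD mC) [X in (X + _)%E](_ : _ = 0%E) ?add0e//.
  apply: (subset_measure0 _ _ _ C0); first exact: measurableD.
    exact: measurableC.
  by rewrite setDE; exact: subIsetr.
rewrite (mI A)// (mI B)//; congr (m _).
by apply/seteqP; split=> x [? Cx]; split=> //; apply/(AB x Cx).
Qed.

(** * Conjugacy of the shift with the skew product *)

Section polar_isomorphism.
Context {R : realType} (Q : {measure set (bisequence R) -> \bar R}) (alpha : R).
Hypothesis alpha_gt0 : 0 < alpha.
Hypothesis shiftQ : forall B : set (bisequence R), measurable B ->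
  Q ((@shiftZ R) @^-1` B) = Q B.
Hypothesis intQ : (\int[Q]_x (Num.min ((x : int -> R) 0 ^+ 2) 1)%:E < +oo)%E.
Hypothesis Q0 : Q [set (fun=> 0)] = 0%E.
Hypothesis negQ : forall B : set (bisequence R), measurable B ->
  Q (dilateZ (-1) @^-1` B) = Q B.
Hypothesis scaleQ : forall (t : R) (B : set (bisequence R)), 0 < t -> measurable B ->
  Q (dilateZ t @^-1` B) = ((t `^ alpha)%:E * Q B)%E.
Variable N : bisequence R -> R.
Hypothesis mN : measurable_fun setT N.
Hypothesis NZ : forall t x, N (dilateZ t x) = t * N x.
Hypothesis N0 : forall x, N x = 0 -> x = fun=> 0.
Hypothesis NQ : Q [set x | 1 < `|N x|] = (2 / alpha)%:E.

Local Notation nu := (polar_measure Q mN).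
Local Notation dir := (direction N).
Local Notation J := (shift_factor N).
Local Notation S := (base_shift mN).
Local Notation Sinv := (base_unshift mN).
Local Notation mu := (nu \x radial_measure alpha)%E.

Definition zeroth_coord : {mfun bisequence R >-> R} :=
  mfun_Sub (mem_set (@measurable_coord R 0)).

(** Since [N y] times coordinate 0 of the direction is y_0, the integral of |x_0|^alpha is, up to 2
    / alpha, the mass Q {|y_0| > 1}, which is finite. *)
Lemma zeroth_coord_Lfun : (zeroth_coord : bisequence R -> R) \in Lfun nu alpha%:E.
Proof.
rewrite !inE; apply/andP; split; rewrite ?inE.
  exact: (@measurable_funPT _ _ _ _ zeroth_coord).
rewrite /mkset /finite_norm unlock; apply: poweR_lty.
have e : (\int[nu]_x (2 / alpha * `|x 0| `^ alpha)%:E < +oo)%E.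
  have := polar_tail_integral alpha_gt0 Q0 negQ scaleQ mN NZ N0 NQ measurableT (measurable_coord 0).
  move=> <-; apply: le_lt_trans (coord_tail_lty shiftQ intQ 0).
  rewrite (_ : mkset _ = [set x : bisequence R | 1 < `|x 0|])//.
  apply/seteqP; split=> y /=; rewrite -[N y * _]/(dilateZ (N y) (dir y) 0) directionK//.
  by case.
move: e; rewrite (_ : (fun x => _) = (fun x : bisequence R => (2 / alpha)%:E * (`|x 0| `^ alpha)%:E)%E); last first.
  by apply/funext => x; rewrite EFinM.
have a0 : 0 < 2 / alpha by rewrite divr_gt0.
rewrite ge0_integralZl//.
- move=> h; have : ((2 / alpha)^-1%:E * ((2 / alpha)%:E * \int[nu]_x (`|x 0| `^ alpha)%:E) < +oo)%E.
    by rewrite lte_mul_pinfty// lee_fin invr_ge0 ltW.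
  by rewrite muleA -EFinM mulVf ?gt_eqF// mul1e.
- apply/measurable_EFinP; apply: (measurableT_comp (measurable_powR _)).
  by apply: measurableT_comp => //; exact: measurable_coord.
- by rewrite lee_fin ltW.
Qed.

Let measurable_shift_factor_sign : measurable_fun setT (fun x => if 0 <= J x then 1 else -1 : R).
Proof.
apply: measurable_fun_ifT => //; apply: measurable_fun_ler => //.
exact: measurable_shift_factor.
Qed.

(** Zeros of the shift factor get the sign 1, so that the values lie in {1, -1} at every point; such
    zeros lie off the cross-section. *)
Definition shift_factor_sign : {mfun bisequence R >-> R} :=
  mfun_Sub (mem_set measurable_shift_factor_sign).

Local Notation xi := shift_factor_sign.

Lemma shift_factor_signP x : xi x = 1 \/ xi x = -1.
Proof. by rewrite /shift_factor_sign /=; case: ifP; [left|right]. Qed.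

Lemma shift_factor_sign_neq0 x : xi x != 0.
Proof. by have [->|->] := shift_factor_signP x; rewrite ?oppr_eq0 oner_neq0. Qed.

Local Notation phi := (maharam_factor nu S Sinv alpha xi zeroth_coord).
Local Notation Rmap := (maharam nu S Sinv alpha xi).
Local Notation Rinv := (maharam_inv nu Sinv alpha xi).

Let measurable_rn : measurable_fun setT (rn_density nu Sinv).
Proof.
have dom : distribution nu Sinv `<< nu.
  apply/null_content_dominatesP => A mA A0.
  exact/(distribution_base_unshift_eq0 alpha_gt0 shiftQ Q0 negQ scaleQ mN NZ N0 NQ).
have dom' : charge_of_finite_measure (distribution nu Sinv) `<< nu by [].
have mRN : measurable_fun setT (fun x => fine (Radon_Nikodym
    (charge_of_finite_measure (distribution nu Sinv)) nu x)).
  by apply: measurableT_comp => //; have /integrableP[] := Radon_Nikodym_integrable dom'.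
by apply: (measurable_fun_ifT (measurable_fun_ltr _ mRN) mRN) => //.
Qed.

Let good : set (bisequence R) :=
  [set x | N x = 1 /\ rn_density nu Sinv x = `|J x| `^ alpha].

Let measurable_good : measurable good.
Proof.
apply: measurableI; apply: measurable_eq_set => //.
apply: (measurableT_comp (measurable_powR _)).
by apply: measurableT_comp => //; exact: measurable_shift_factor.
Qed.

Let good_conull : nu (~` good) = 0%E.
Proof.
have h1 := gauge_ae1 alpha_gt0 mN NZ NQ.
have h2 := rn_density_ae alpha_gt0 shiftQ Q0 negQ scaleQ mN NZ N0 NQ.
have : {ae nu, forall x, good x} by apply: filterS2 h1 h2 => x; split.
move=> [Z [mZ Z0 GZ]]; apply: (subset_measure0 _ mZ _ Z0) => //.
exact: measurableC.
Qed.

(** The exponent 1/alpha turns the derivative |J|^alpha back into |J|, and [xi] restores the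
    sign. *)
Let cocycle_good x : good x -> cocycle nu Sinv alpha xi x = J x.
Proof.
move=> [_ rnx]; rewrite /cocycle rnx -powRrM divff ?gt_eqF// powRr1//=.
by case: ifPn => [|/negP/negP]; rewrite ?mul1r -?ltNge ?mulN1r;
  [move=> /ger0_norm|move=> /ltr0_norm ->; rewrite opprK].
Qed.

Let maharam_polar y : N y != 0 -> good (dir y) -> Rmap (polar N y) = polar N (shiftZ y).
Proof.
move=> Ny gy; rewrite /maharam /polar /= (cocycle_good gy); congr (_, _).
  rewrite /base_map gauge_direction// eqxx /direction -/(direction N y) shiftZ_dilateZ.
  by rewrite -/(direction N _) direction_dilateZ// invr_eq0.
by rewrite /shift_factor mulrC -NZ -shiftZ_dilateZ directionK.
Qed.

Definition shiftn (n : int) (x : bisequence R) : bisequence R := fun m => x (m + n).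

Let measurable_shiftn n : measurable_fun setT (shiftn n).
Proof. by apply: measurable_bisequence => m; exact: measurable_coord. Qed.

Let shiftn_comp m n x : shiftn m (shiftn n x) = shiftn (m + n) x.
Proof. by apply/funext => k; rewrite /shiftn addrA. Qed.

Let shiftn0 x : shiftn 0 x = x.
Proof. by apply/funext => k; rewrite /shiftn addr0. Qed.

Let shiftn_inv n B : measurable B -> Q (shiftn n @^-1` B) = Q B.
Proof.
have pos (k : nat) C : measurable C -> Q (shiftn k%:Z @^-1` C) = Q C.
  elim: k C => [|k IH] C mC.
    by congr (Q _); apply/funext => x; exact: congr1 (shiftn0 x).
  rewrite -[RHS]IH// -[RHS]shiftQ.
    congr (Q _); apply/funext => x /=; apply: congr1.
    by apply/funext => m; rewrite /shiftn /shiftZ -addrA -PoszD addn1.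
  by rewrite -[X in measurable X]setTI; exact: measurable_shiftn.
move=> mB; case: n => k; first exact: pos.
rewrite -(pos k.+1); last by rewrite -[X in measurable X]setTI; exact: measurable_shiftn.
congr (Q _); apply/funext => x /=; apply: congr1.
by rewrite shiftn_comp NegzE addNr shiftn0.
Qed.

Let gauge_shiftn_neq0 n x : N x != 0 -> N (shiftn n x) != 0.
Proof.
apply: contra => /eqP/N0 sx; rewrite -(shiftn0 x) -(addNr n) -shiftn_comp sx.
have := NZ 0 (fun=> 0); rewrite mul0r => h.
by rewrite (_ : shiftn _ _ = dilateZ 0 (fun=> 0)) ?h//; apply/funext => k; rewrite /dilateZ mul0r.
Qed.

(** A shift-invariant set, so the conjugation holds pointwise along whole orbits, in both directions
    of time. *)
Let A2 : set (bisequence R) := [set y | N y != 0 /\ forall n, good (dir (shiftn n y))].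

(** [A2] in polar coordinates. Confining [p.1] to the cross-section makes (x, t) |-> t x
    injective. *)
Let A1 : set (bisequence R * R) :=
  [set p | [/\ p.2 != 0, N p.1 = 1 & A2 (dilateZ p.2 p.1)]].

Let A2_shiftn n y : A2 y -> A2 (shiftn n y).
Proof.
by move=> [Ny gy]; split=> [|m]; [exact: gauge_shiftn_neq0|rewrite shiftn_comp].
Qed.

Let measurable_gauge_neq0 : measurable [set y | N y != 0].
Proof.
rewrite (_ : mkset _ = ~` [set y | N y = 0]).
  by apply: measurableC; exact: measurable_eq_set.
by apply/seteqP; split=> y /= /eqP.
Qed.

Let A2E : A2 = [set y | N y != 0] `&`
  \bigcap_k (if unpickle k is Some n then (dir \o shiftn n) @^-1` good else setT).
Proof.
apply/seteqP; split=> y [/= Ny gy]; split=> //.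
  by move=> k _; case: unpickle.
by move=> n; have := gy (pickle n) I; rewrite pickleK.
Qed.

Let measurable_dir_shiftn n : measurable_fun setT (dir \o shiftn n).
Proof. by apply: measurableT_comp => //; exact: measurable_direction. Qed.

Let measurable_A2 : measurable A2.
Proof.
rewrite A2E; apply: measurableI => //; apply: bigcap_measurableType => k _.
case: unpickle => // n; rewrite -[X in measurable X]setTI.
exact: measurable_dir_shiftn.
Qed.

Let polarE X : measurable X -> mu X = Q (polar N @^-1` X).
Proof. exact: polar_product. Qed.

(** Apart from the zero sequence, the complement is the union over n in Z of the shifts of a single
    bad set. That set is null by the product formula, and so are its shifts by invariance. *)
Let A2_conull : Q (~` A2) = 0%E.
Proof.
have bad0 : Q (dir @^-1` ~` good) = 0%E.
  have := polarE (measurableX (measurableC measurable_good) (@measurableT _ R)).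
  rewrite product_measure1E//; last exact: measurableC.
  rewrite [X in (X * _)%E]good_conull mul0e => ->; congr (Q _).
  by apply/seteqP; split=> y //= [].
have mbad : measurable (dir @^-1` ~` good).
  by rewrite -[X in measurable X]setTI; apply: measurable_direction => //; exact: measurableC.
have null0 : Q [set y | N y = 0] = 0%E.
  rewrite (_ : mkset _ = [set (fun=> 0)])//.
  apply/seteqP; split=> y; first exact: N0.
  move=> ->; have := NZ 0 (fun=> 0); rewrite mul0r.
  by rewrite (_ : dilateZ 0 _ = fun=> 0)//; apply/funext => k; rewrite /dilateZ mul0r.
pose F k := if unpickle k is Some n then shiftn n @^-1` (dir @^-1` ~` good) else set0.
have mF k : measurable (F k).
  rewrite /F; case: unpickle => // n; rewrite -[X in measurable X]setTI.
  exact: measurable_shiftn.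
have mN0 : measurable [set y | N y = 0] by exact: measurable_eq_set.
apply/eqP; rewrite -measure_le0.
apply: (@le_trans _ _ (Q ([set y | N y = 0] `|` \bigcup_k F k))).
  apply: le_measure; rewrite ?inE.
  - exact: measurableC.
  - by apply: measurableU => //; exact: bigcup_measurable.
  move=> y nA2; have [Ny|Ny] := eqVneq (N y) 0; first by left.
  right; apply: contrapT => nF; apply: nA2; split=> // n; apply: contrapT => ng.
  by apply: nF; exists (pickle n) => //; rewrite /F pickleK.
apply: (le_trans (measureU2 _ mN0 (bigcup_measurable (fun k _ => mF k)))).
rewrite [X in (X + _)%E]null0 add0e.
apply: (le_trans (measure_sigma_subadditive _ mF (bigcup_measurable (fun k _ => mF k)) (@subset_refl _ _))).
rewrite eseries0// => k _ _; rewrite /F; case: unpickle => [n|]; last by rewrite measure0.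
by rewrite shiftn_inv.
Qed.

Let dilate_polar y : dilateZ (polar N y).2 (polar N y).1 = y.
Proof. exact: directionK. Qed.

Let polar_A1 y : A1 (polar N y) <-> A2 y.
Proof.
split=> [[_ _]|[Ny gy]]; first by rewrite dilate_polar.
by split=> //=; [exact: gauge_direction|rewrite directionK].
Qed.

Let polar_dilate p : A1 p -> polar N (dilateZ p.2 p.1) = p.
Proof.
case: p => x t [/= t0 Nx _]; rewrite /polar direction_dilateZ// direction_id//.
by rewrite NZ Nx mulr1.
Qed.

Let measurable_dilate : measurable_fun setT (fun p : bisequence R * R => dilateZ p.2 p.1).
Proof.
apply: measurable_bisequence => n; apply: measurable_funM => //.
exact: (measurableT_comp (measurable_coord n) measurable_fst).
Qed.

Let measurable_snd_neq0 : measurable [set p : bisequence R * R | p.2 != 0].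
Proof.
rewrite (_ : mkset _ = ~` [set p | p.2 = 0]).
  by apply: measurableC; exact: measurable_eq_set.
by apply/seteqP; split=> y /= /eqP.
Qed.

Let measurable_A1 : measurable A1.
Proof.
rewrite (_ : A1 = [set p | p.2 != 0] `&` ([set p | N p.1 = 1] `&`
    (fun p : bisequence R * R => dilateZ p.2 p.1) @^-1` A2)).
  apply: measurableI => //; apply: measurableI.
    by apply: measurable_eq_set => //; exact: measurableT_comp.
  by rewrite -[X in measurable X]setTI; exact: measurable_dilate.
by apply/seteqP; split=> p; [case|move=> [? []]].
Qed.

Let maharam_A2 y : A2 y -> Rmap (polar N y) = polar N (shiftZ y).
Proof. by move=> [Ny gy]; apply: maharam_polar => //; have := gy 0; rewrite shiftn0. Qed.

(** Cancellation of the forward identity at the unshifted sequence, which is again in [A2]. *)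
Let maharam_inv_A2 y : A2 y -> Rinv (polar N y) = polar N (shiftn (-1) y).
Proof.
move=> Ay; have := maharam_A2 (A2_shiftn (-1) Ay).
have -> : shiftZ (shiftn (-1) y) = y by apply/funext => k; rewrite /shiftZ /shiftn addrK.
move=> <-; apply: maharamK; last exact: shift_factor_sign_neq0.
exact: base_shiftK.
Qed.

Let maharam_iter_A2 n y : A2 y ->
  maharam_iter nu S Sinv alpha xi n (polar N y) = polar N (shiftn n y).
Proof.
move=> Ay; case: n => k.
  elim: k => [|k IH]; first by rewrite /= shiftn0.
  rewrite /maharam_iter iterS -/(maharam_iter nu S Sinv alpha xi (Posz k)) IH.
  rewrite maharam_A2; last exact: A2_shiftn.
  congr polar; apply/funext => m; rewrite /shiftZ /shiftn.
  by rewrite -addrA -[k.+1]add1n PoszD.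
rewrite /maharam_iter; elim: k => [|k IH]; first by rewrite [LHS]/= maharam_inv_A2.
rewrite iterS IH maharam_inv_A2; last exact: A2_shiftn.
by rewrite shiftn_comp !NegzE -opprD -[k.+2]add1n PoszD.
Qed.

(** At time n the orbit of polar [y] sits at the polar coordinates of its n-th shift, where M
    returns coordinate 0 of that shift, namely y_n. The factor map is thus the inverse of
    [polar]. *)
Let phi_A1 p : A1 p -> phi p = dilateZ p.2 p.1.
Proof.
move=> Ap; have [_ _ Ay] := Ap; apply/funext => n.
rewrite /maharam_factor -{1 2}(polar_dilate Ap) maharam_iter_A2//.
rewrite -[LHS]/(dilateZ (N (shiftn n _)) (dir (shiftn n _)) 0) directionK//.
by rewrite /shiftn add0r.
Qed.

Let measurable_Rmap : measurable_fun setT Rmap.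
Proof.
apply: measurable_fun_pair.
  exact: (measurableT_comp (@measurable_funPT _ _ _ _ S) measurable_fst).
apply: measurable_funM => //.
apply: (measurableT_comp (_ : measurable_fun setT (cocycle nu Sinv alpha xi)) measurable_fst).
apply: measurable_funM; first exact: (@measurable_funPT _ _ _ _ xi).
exact: (measurableT_comp (measurable_powR _)).
Qed.

(** In polar coordinates this is the shift invariance of Q; the two maps agree on [A2], and the rest
    is null. *)
Lemma maharam_measure_preserving :
  measure_preserving [set p : bisequence R * R | p.2 != 0] mu Rmap.
Proof.
split=> //.
- move=> [x t] /= t0; rewrite mulf_neq0// cocycle_neq0//.
  exact: shift_factor_sign_neq0.
- exact: measurable_funTS.
move=> B mB BD.
have mRB : measurable (Rmap @^-1` B).
  by rewrite -[X in measurable X]setTI; exact: measurable_Rmap.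
have mpol X : measurable X -> measurable (polar N @^-1` X).
  by move=> mX; rewrite -[X in measurable X]setTI; exact: measurable_polar.
rewrite !polarE//; last exact: measurableI.
rewrite -[RHS]shiftQ; last exact: mpol.
apply: (eq_measure_conull _ _ measurable_A2 A2_conull).
- by apply: mpol; exact: measurableI.
- by rewrite -[X in measurable X]setTI; apply: measurable_shiftZ => //; exact: mpol.
move=> y Ay; have := maharam_A2 Ay => Ry; have [Ny _] := Ay.
split; first by move=> [_]; rewrite /preimage /mkset Ry.
by move=> By; split=> //; rewrite /preimage /mkset Ry.
Qed.

Lemma maharam_isomorphism :
  mps_isomorphism [set p : bisequence R * R | p.2 != 0] mu Rmap setT Q (@shiftZ R) phi.
Proof.
have phiB B : B `<=` A1 -> phi @` B = A2 `&` polar N @^-1` B.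
  move=> BA; apply/seteqP; split=> [_ [p Bp <-]|y [Ay By]].
    have Ap := BA _ Bp; rewrite phi_A1//; split; first by case: Ap.
    by rewrite /preimage /mkset polar_dilate.
  by exists (polar N y) => //; rewrite phi_A1 ?dilate_polar//; exact: BA.
have mpol X : measurable X -> measurable (polar N @^-1` X).
  by move=> mX; rewrite -[X in measurable X]setTI; exact: measurable_polar.
exists A1, A2; split.
- split=> //; first by move=> p [].
  rewrite polarE; last exact: measurableD.
  apply: (subset_measure0 _ _ _ A2_conull); last first.
  + by move=> y [_ nA] Ay; apply: nA; exact/polar_A1.
  + exact: measurableC.
  + by apply: mpol; exact: measurableD.
- by split=> //; rewrite setTD.
- split.
  + split.
    * by move=> p Ap; rewrite /= phi_A1//; case: Ap.
    * move=> p q; rewrite !inE => Ap Aq; rewrite !phi_A1// => pq.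
      by rewrite -(polar_dilate Ap) -(polar_dilate Aq) pq.
    * move=> y Ay; have Ap : A1 (polar N y) by exact/polar_A1.
      by exists (polar N y) => //; rewrite phi_A1// dilate_polar.
  + apply: (eq_measurable_fun (fun p : bisequence R * R => dilateZ p.2 p.1)).
      by move=> p /set_mem Ap; rewrite phi_A1.
    exact: measurable_funTS.
  + by move=> B mB BA; rewrite phiB//; apply: measurableI => //; exact: mpol.
- move=> B mB BA.
  have -> : A1 `&` phi @^-1` B = A1 `&` (fun p : bisequence R * R => dilateZ p.2 p.1) @^-1` B.
    by apply/seteqP; split=> p [Ap Bp]; split=> //; move: Bp;
      rewrite /preimage /mkset phi_A1.
  rewrite polarE; last first.
    by apply: measurableI => //; rewrite -[X in measurable X]setTI; exact: measurable_dilate.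
  congr (Q _); apply/seteqP; split=> y; first by move=> [_]; rewrite /preimage /mkset dilate_polar.
  move=> By; split; first by apply/polar_A1; exact: BA.
  by rewrite /preimage /mkset dilate_polar.
- move=> p Ap; have [_ _ Ay] := Ap; rewrite (phi_A1 Ap) -{1}(polar_dilate Ap) maharam_A2//.
  rewrite phi_A1 ?dilate_polar//; apply/polar_A1.
  exact: (A2_shiftn 1).
Qed.

End polar_isomorphism.

Theorem theorem8 (R : realType) (alpha : R) (alpha_gt0 : 0 < alpha)
  (alpha_lt2 : alpha < 2)
  (d : measure_display) (W : measurableType d) (P : probability W R)
  (Y : {RV P >-> bisequence R})
  (Q : {sigma_finite_measure set (bisequence R) -> \bar R})
  (Y_stable : is_stable P Y Q alpha) (Y_symmetric : symmetric_process P Y) :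
  exists (dX : measure_display) (X : measurableType dX) (nu : probability X R)
    (S Sinv : {mfun X >-> X}) (f xi : {mfun X >-> R}),
    [/\ standard_borel R X,
        nonsingular_automorphism nu S Sinv,
        (f : X -> R) \in Lfun nu alpha%:E,
        (forall x, xi x = 1 \/ xi x = -1) &
        let D := [set p : X * R | p.2 != 0] in
        let mu := (nu \x (radial_measure alpha))%E in
        let Salpha := maharam nu S Sinv alpha xi in
        measure_preserving D mu Salpha /\
        mps_isomorphism D mu Salpha setT Q (@shiftZ R)
          (maharam_factor nu S Sinv alpha xi f)].
Proof.
have [[_ _ YQ] QT scaleQ] := Y_stable.
have [shiftQ Q0 intQ _] := YQ.
have negQ := Levy_measure_symmetric YQ Y_symmetric.
have [N [mN NZ N0 NQ]] := exists_stable_gauge alpha_gt0 shiftQ intQ Q0 QT scaleQ.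
exists _, (bisequence R), (polar_measure Q mN), (base_shift mN), (base_unshift mN).
exists zeroth_coord, (shift_factor_sign mN); split.
- exact: standard_borel_bisequence.
- exact: (nonsingular_base_shift alpha_gt0).
- exact: zeroth_coord_Lfun.
- exact: shift_factor_signP.
split; first exact: maharam_measure_preserving.
exact: maharam_isomorphism.
Qed.
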